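(* Let $n\ge1$, $D=[0,1]^n$, $1\le p\le3$, $\mathbf{r}\in\{0,1\}^n$, and $M=\{i\in\{1,\dots,n\}: r_i=1\}$. Let $\Omega:[0,\infty)\to\mathbb{R}$ be an arbitrary concave univariate MC-type function. Then for every $\mathbf{m}=(m_1,\dots,m_n)\in\mathbb{N}^n$ with $m_i\ge2$, $i=1,\dots,n$, $$E^{\mathbf{r}}_{\mathbf{m}}\left(C^{\mathbf{r}}_{D,p}(\Omega)\right)=\left(\prod_{i\in M}m_i\right)\int_R\Omega\left(\left(\sum_{i\in M}\gamma_i^p+\sum_{i\notin M}\frac{1}{(2m_i)^p}\right)^{1/p}\right)\prod_{i\in M}d\gamma_i,$$ where $R=\prod_{i\in M}[0,\frac1{m_i}]$. Here $$E^{\mathbf{r}}_{\mathbf{m}}(C^{\mathbf{r}}_{D,p}(\Omega))=\sup\left\{\sup_{\mathbf{x}\in D}\left|f^{(\mathbf{r})}(\mathbf{x})-S^{(\mathbf{r})}_{\mathbf{m}}(f;\mathbf{x})\right| : f\in C^{\mathbf{r}}_{D,p}(\Omega)\right\}.$$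
   Context: Univariate MC-type function: a function $\Omega$ on $[0,\infty)$ such that (1) $\Omega(0)=0$; (2) $\Omega$ is non-decreasing; (3) $\Omega(\tau+\gamma)\le\Omega(\tau)+\Omega(\gamma)$ for all $\tau,\gamma\ge0$; (4) $\Omega$ is continuous. Derivatives and smoothness: for $\mathbf{t}\in\{0,1\}^n$, $f^{(\mathbf{t})}=\dfrac{\partial^{t_1+\dots+t_n}f}{\partial x_1^{t_1}\cdots\partial x_n^{t_n}}$, with $f^{(\mathbf{0})}=f$. $C^{\mathbf{r}}_D$ is the class of continuous functions $f:D\to\mathbb{R}$ having continuous derivatives $f^{(\mathbf{t})}$ on $D$ for all $\mathbf{t}\in\{0,1\}^n$ with $t_i\le r_i$, $i=1,\dots,n$. Modulus of continuity with respect to $p$: with $\|\mathbf{x}-\mathbf{y}\|_p=\left(\sum_{i=1}^n|x_i-y_i|^p\right)^{1/p}$, for continuous $g$ on $D$, $$\omega_p(g;\gamma)=\sup\{|g(\mathbf{x})-g(\mathbf{y})| : \mathbf{x},\mathbf{y}\in D,\ \|\mathbf{x}-\mathbf{y}\|_p\le\gamma\},\qquad 0\le\gamma\le n^{1/p}.$$ Class $C^{\mathbf{r}}_{D,p}(\Omega)$: all $f\in C^{\mathbf{r}}_D$ with $\omega_p(f^{(\mathbf{r})};\gamma)\le\Omega(\gamma)$ for all $0\le\gamma\le n^{1/p}$. Interpolating multilinear spline: given $\mathbf{m}\in\mathbb{N}^n$, the nodes are $\mathbf{x}^{\mathbf{j}}=(j_1/m_1,\dots,j_n/m_n)$, $j_i\in\{0,\dots,m_i\}$.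 For continuous $f$ on $D$ and $\mathbf{x}$ in the block $D_{\mathbf{j}}=\prod_{i=1}^n[\frac{j_i}{m_i},\frac{j_i+1}{m_i}]$, $j_i\in\{0,\dots,m_i-1\}$, $$S_{\mathbf{m}}(f;\mathbf{x})=\sum_{\mathbf{l}\in\{0,1\}^n} f(\mathbf{x}^{\mathbf{j}+\mathbf{l}})\prod_{i=1}^n H_{l_i,j_i}(x_i),\quad H_{0,j_i}(x_i)=m_i\left(\tfrac{j_i+1}{m_i}-x_i\right),\quad H_{1,j_i}(x_i)=1-H_{0,j_i}(x_i);$$ this is the unique function on $D$ that is of degree at most one in each variable separately on every block and interpolates $f$ at all nodes. Derivative of the spline: it may be discontinuous across block boundaries, and $S^{(\mathbf{r})}_{\mathbf{m}}(f;\mathbf{x})$ is defined at every $\mathbf{x}\in D$ as follows. Partition $D$ into the sets $D'_{\mathbf{j}}=\prod_{i=1}^n I_{i}$, where $I_i=[\frac{j_i}{m_i},\frac{j_i+1}{m_i})$ if $0\le j_i\le m_i-2$ and $I_i=[\frac{j_i}{m_i},\frac{j_i+1}{m_i}]$ if $j_i=m_i-1$. For $\mathbf{x}\in D'_{\mathbf{j}}$, $S^{(\mathbf{r})}_{\mathbf{m}}(f;\mathbf{x})$ is the value at $\mathbf{x}$ of the $\mathbf{r}$-th partial derivative of the polynomial representing $S_{\mathbf{m}}(f;\cdot)$ on $D_{\mathbf{j}}$, i.e. $$S^{(\mathbf{r})}_{\mathbf{m}}(f;\mathbf{x})=\left(\prod_{i\in M}m_i\right)\sum_{\mathbf{l}\in\{0,1\}^n}(-1)^{|M|+\sum_{i\in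 M}l_i}\left(\prod_{i\notin M}H_{l_i,j_i}(x_i)\right)f(\mathbf{x}^{\mathbf{j}+\mathbf{l}}).$$ Convention: if $M=\emptyset$, empty products equal $1$, empty sums equal $0$, and the integral over $R$ is simply the value of the integrand. *)

(* Defs.v *)
From HB Require Import structures.
From mathcomp Require Import all_boot all_order all_algebra.
From mathcomp Require Import all_classical all_reals all_analysis.

Set Implicit Arguments.
Unset Strict Implicit.
Unset Printing Implicit Defensive.

Import Order.TTheory GRing.Theory Num.Theory.
Import numFieldNormedType.Exports.

Local Open Scope classical_set_scope.
Local Open Scope ring_scope.

Record MC_type (R : realType) (Omega : R -> R) : Prop := MCType {
  MC_0 : Omega 0 = 0;
  MC_nondecreasing : {in `[0, +oo[ &, {homo Omega : x y / x <= y}};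
  MC_subadditive : {in `[0, +oo[ &, forall t g : R,
    Omega (t + g) <= Omega t + Omega g};
  MC_continuous : {within `[0, +oo[, continuous Omega} }.

Definition concave_function (R : realType) (A : set R) (F : R -> R) :=
  convex_function (A : set R^o) (fun x => - F x).

Section multivariate.
Context {R : realType} {n : nat}.
Implicit Types (A : set 'rV[R]_n) (f g : 'rV[R]_n -> R) (x y : 'rV[R]_n).
Implicit Types (i : 'I_n) (s : seq 'I_n) (t r : {ffun 'I_n -> bool}).
Implicit Types (m j : 'I_n -> nat).

Definition unit_cube : set 'rV[R]_n := [set x | forall i, 0 <= x 0 i <= 1].

(* The difference quotient only sees increments that stay in A: for A the
   closed cube, partial derivatives on the faces are one-sided, and they depend
   only on the restriction of the function to A. *)
Definition diff_quotient A i f x : set_system R :=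
  h^-1 * (f (x + h *: delta_mx 0 i) - f x)
    @[h --> within [set h : R | A (x + h *: delta_mx 0 i)] 0^'].

Definition partial A i f x : R := lim (diff_quotient A i f x).

Definition has_partial A i f := forall x, A x -> cvg (diff_quotient A i f x).

(* For s = [:: i1; ...; ik] this is d^k f / dx_i1 ... dx_ik, the derivative
   with respect to x_ik being taken first. *)
Definition partials A s f := foldr (partial A) f s.

Fixpoint has_partials A s f : Prop :=
  if s is i :: s' then has_partials A s' f /\ has_partial A i (partials A s' f)
  else True.

Definition supp t : {set 'I_n} := finset (fun i => t i).

Definition mderiv A t f := partials A (enum (supp t)) f.

Definition has_mderiv A t f := has_partials A (enum (supp t)) f.

Definition C_class A r : set ('rV[R]_n -> R) :=
  [set f | forall t, (forall i, (t i <= r i)%N) ->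
     has_mderiv A t f /\ {within A, continuous (mderiv A t f)}].

Definition pnorm (p : R) x : R := (\sum_i `|x 0 i| `^ p) `^ p^-1.

Definition modulus A p g (gamma : R) : \bar R :=
  ereal_sup [set e | exists x y,
    [/\ A x, A y, pnorm p (x - y) <= gamma & e = `|g x - g y|%:E]].

Definition C_class_modulus r p (Omega : R -> R) : set ('rV[R]_n -> R) :=
  [set f | C_class unit_cube r f /\
     forall gamma, 0 <= gamma <= n%:R `^ p^-1 ->
       (modulus unit_cube p (mderiv unit_cube r f) gamma <= (Omega gamma)%:E)%E].

Definition node m j : 'rV[R]_n := \row_i ((j i)%:R / (m i)%:R).

Definition spline_basis (mi ji : nat) (b : bool) (u : R) : R :=
  let H0 := mi%:R * (ji.+1%:R / mi%:R - u) in if b then 1 - H0 else H0.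

(* The polynomial, on the whole space, that represents the spline on the
   block of index j. *)
Definition spline_piece m f j x : R :=
  \sum_(l : {ffun 'I_n -> bool}) f (node m (fun i => j i + l i)%N) *
         \prod_i spline_basis (m i) (j i) (l i) (x 0 i).

(* The sets [half_open_block m j], for j_i < m_i, partition the cube. *)
Definition half_open_block m j : set 'rV[R]_n :=
  [set x | forall i, (j i)%:R / (m i)%:R <= x 0 i /\
     (if j i == (m i).-1 then x 0 i <= (j i).+1%:R / (m i)%:R
      else x 0 i < (j i).+1%:R / (m i)%:R)].

Definition block m x i : nat := minn (Num.truncn ((m i)%:R * x 0 i)) (m i).-1.

Lemma block_lt m x i : (0 < m i)%N -> (block m x i < m i)%N.
Proof. by move=> mi; rewrite /block gtn_min (ltn_predL (m i)) mi orbT. Qed.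

Lemma half_open_block_block m x : (forall i, 0 < m i)%N -> unit_cube x ->
  half_open_block m (block m x) x.
Proof.
move=> m_gt0 xD i; have mi := m_gt0 i; have /andP[x0 x1] := xD i.
have miR : 0 < (m i)%:R :> R by rewrite ltr0n.
have /andP[lo hi] : (Num.truncn ((m i)%:R * x 0 i))%:R <= (m i)%:R * x 0 i
    < (Num.truncn ((m i)%:R * x 0 i)).+1%:R.
  by apply: truncn_itv; rewrite mulr_ge0 // ltW.
split.
  rewrite ler_pdivrMr // [leRHS]mulrC; apply: le_trans lo.
  by rewrite ler_nat geq_minl.
case: eqP => [->|]; first by rewrite prednK // divff ?gt_eqF.
rewrite /block /minn; case: ltnP => // _ _.
by rewrite ltr_pdivlMr // [ltLHS]mulrC.
Qed.

Definition spline_deriv m r f x : R :=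
  mderiv setT r (spline_piece m f (block m x)) x.

Definition worst_error m r (F : set ('rV[R]_n -> R)) : \bar R :=
  ereal_sup [set ereal_sup
    [set `|mderiv unit_cube r f x - spline_deriv m r f x|%:E | x in unit_cube]
    | f in F].

Definition set_coord x i (u : R) : 'rV[R]_n :=
  \row_k (if k == i then u else x 0 k).

(* Multiple integral over the product of the intervals [0, b i], i \in M, of a
   function of the coordinates in M, as iterated Lebesgue integrals; the other
   coordinates of the argument are 0. It is [G 0] when M is empty. *)
Definition box_integral (M : {set 'I_n}) (b : 'I_n -> R)
    (G : 'rV[R]_n -> \bar R) : \bar R :=
  foldr (fun i (K : 'rV[R]_n -> \bar R) x =>
      (\int[lebesgue_measure]_(u in `[0%R, b i]) K (set_coord x i u))%E)
    G (enum M) 0.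

End multivariate.

(* Main.v *)
(** Write [L_i] for linear interpolation in [x_i] between the two knots of the
    block and [Delta_i] for the increment between them.  The spline polynomial is
    fixed by every [L_i], hence its [r]-th derivative is [\prod_M m_i] times
    [Delta_M (L_{~M} f)].  Since [d_M (L_{~M} f) = L_{~M} f^(r)], the error at [x]
    is an average of values of [f^(r) x - f^(r)], to which the modulus of
    continuity applies.  In the directions outside [M], Jensen's inequality for
    the concave function [v |-> Omega (v^(1/p))] together with
    [(1 - s) s^p + s (1 - s)^p <= 2^-p] (this is where [p <= 3] enters) replaces
    the distances to the knots by half a step; in the directions of [M], moving
    [x] to a corner of the block only increases the integral.  Both steps are
    equalities for the iterated primitive [f] of
    [f^(r) = Omega (pnorm (. - x0))], at the point [x0] with coordinates 0 in [M]
    and half a step outside [M]. *)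
Require Import Defs.
From HB Require Import structures.
From mathcomp Require Import all_boot all_order all_algebra.
From mathcomp Require Import all_classical all_reals all_analysis.
From mathcomp Require Import ring lra.

Set Implicit Arguments.
Unset Strict Implicit.
Unset Printing Implicit Defensive.

Import Order.TTheory GRing.Theory Num.Theory.
Import numFieldNormedType.Exports.

Local Open Scope classical_set_scope.
Local Open Scope ring_scope.

(** * One variable: derivatives and primitives *)

Section one_variable.
Context {R : realType}.
Implicit Types (a b c e t u v : R) (f g : R -> R).

(** Allow a loss of [e] per unit length and take the supremum [c] of the points up to which the
    bound holds. The straddling hypothesis at [c] compares a point to its left with one to its
    right, so the bound passes beyond [c] unless [c = b]. Then [e] tends to 0. *)
Lemma nondecreasing_straddle a b f : a <= b ->
  (forall u, a <= u <= b -> forall e, 0 < e -> exists2 d, 0 < d &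
     forall s t, a <= s <= u -> u <= t <= b -> t - s < d ->
       f s <= f t + e * (t - s)) ->
  f a <= f b.
Proof.
move=> ab H.
suff He e : 0 < e -> f a <= f b + e * (b - a).
  apply/ler_addgt0Pr => e e0.
  have d0 : 0 < b - a + 1 by lra.
  apply: (le_trans (He _ (divr_gt0 e0 d0))).
  have : (b - a + 1)^-1 * (b - a) <= 1 by rewrite ler_pdivrMl //; lra.
  by move=> /(ler_wpM2l (ltW e0)); rewrite mulrA mulr1 lerD2l.
move=> e0.
pose A : set R := [set u | a <= u <= b /\ f a <= f u + e * (u - a)].
have Aa : A a by split; [rewrite lexx ab | rewrite subrr mulr0 addr0].
have supA : has_sup A.
  by split; [exists a | exists b => u [/andP[]]].
set c := sup A.
have ac : a <= c by apply: ub_le_sup => //; case: supA.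
have cb : c <= b by apply: ge_sup => [|u [/andP[]] //]; exists a.
have [//|d d0 Hd] := H c _ e e0; first by rewrite ac cb.
(* The width [d] is split in two: [s] lies less than [d / 2] to the left of [c], and points less
   than [d / 2] to the right inherit membership in [A]. *)
have [s As sc] := sup_adherent (divr_gt0 d0 (ltr0n _ 2)) supA.
have sle : s <= c by apply: ub_le_sup => //; case: supA.
have Ht t : c <= t <= b -> t - c < d / 2 -> A t.
  case: As => /andP[as_ sb] fs ct td; case/andP: (ct) => ct1 tb.
  split; first by lra.
  have := Hd s t; rewrite as_ sle ct => /(_ isT isT) H2.
  have {}H2 : f s <= f t + e * (t - s) by apply: H2; rewrite -/c in sc; lra.
  lra.
have [bc|cltb] := leP b c.
  have [_] : A b by apply: Ht; [rewrite cb lexx | lra].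
  by [].
(* This step leads strictly beyond [c], stays in the interval and is below [d / 2], so the new point
   would lie in [A], against the choice of [c]. *)
have tmin : 0 < Num.min (b - c) (d / 3) by rewrite lt_min; apply/andP; split; lra.
have m1 : Num.min (b - c) (d / 3) <= b - c by rewrite ge_min lexx.
have m2 : Num.min (b - c) (d / 3) <= d / 3 by rewrite ge_min lexx orbT.
have At : A (c + Num.min (b - c) (d / 3)) by apply: Ht; [apply/andP; split|]; lra.
have : c + Num.min (b - c) (d / 3) <= c by apply: ub_le_sup => //; case: supA.
by lra.
Qed.

(** The derivative relative to the closed interval, one-sided at the ends. The division-free form
    makes [v = u] harmless and turns integration of the estimate into integration of both sides. *)
Definition deriv_on a b f f' := forall u, a <= u <= b -> forall e, 0 < e ->
  exists2 d, 0 < d & forall v, a <= v <= b -> `|v - u| < d ->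
    `|f v - f u - f' u * (v - u)| <= e * `|v - u|.

Lemma deriv_on_sub a b c d f f' : c <= a -> b <= d ->
  deriv_on c d f f' -> deriv_on a b f f'.
Proof.
move=> ca bd H u /andP[au ub] e e0.
have [|r r0 Hr] := H u _ e e0; first by lra.
by exists r => // v /andP[av vb]; apply: Hr; lra.
Qed.

Lemma deriv_onB a b f g f' g' : deriv_on a b f f' -> deriv_on a b g g' ->
  deriv_on a b (fun u => f u - g u) (fun u => f' u - g' u).
Proof.
move=> Hf Hg u uab e e0.
have e2 : 0 < e / 2 by lra.
have [r r0 Hr] := Hf u uab _ e2; have [s s0 Hs] := Hg u uab _ e2.
exists (Num.min r s) => [|v vab]; first by rewrite lt_min r0 s0.
rewrite lt_min => /andP[/(Hr v vab) H1 /(Hs v vab) H2].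
have -> : f v - g v - (f u - g u) - (f' u - g' u) * (v - u) =
  (f v - f u - f' u * (v - u)) - (g v - g u - g' u * (v - u)) by ring.
by apply: le_trans (ler_normB _ _) _; lra.
Qed.

Lemma deriv_onN a b f f' : deriv_on a b f f' ->
  deriv_on a b (fun u => - f u) (fun u => - f' u).
Proof.
move=> Hf u uab e e0; have [r r0 Hr] := Hf u uab _ e0.
exists r => // v vab vu; have := Hr v vab vu; rewrite -normrN.
by congr (_ <= _); congr (`| _ |); ring.
Qed.

Lemma deriv_on_mulr a b c : deriv_on a b (fun u => c * u) (fun=> c).
Proof.
move=> u _ e e0; exists 1 => // v _ _.
have -> : c * v - c * u - c * (v - u) = 0 by ring.
by rewrite normr0 mulr_ge0 // ltW.
Qed.

Lemma deriv_on_shift a b c f f' : deriv_on (a + c) (b + c) f f' ->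
  deriv_on a b (fun u => f (u + c)) (fun u => f' (u + c)).
Proof.
move=> Hf u uab e e0; have [|r r0 Hr] := Hf (u + c) _ _ e0; first by lra.
exists r => // v vab vu; have E : v + c - (u + c) = v - u by ring.
by have := Hr (v + c); rewrite E; apply => //; lra.
Qed.

Lemma deriv_on_reflect a b c f f' : deriv_on (c - b) (c - a) f f' ->
  deriv_on a b (fun u => - f (c - u)) (fun u => f' (c - u)).
Proof.
move=> Hf u uab e e0; have [|r r0 Hr] := Hf (c - u) _ _ e0; first by lra.
exists r => // v vab vu; have E : c - v - (c - u) = - (v - u) by ring.
have := Hr (c - v); rewrite E normrN => /(_ _ vu) H.
rewrite -normrN; apply: le_trans (H _); last by lra.
by rewrite le_eqVlt; apply/orP; left; apply/eqP; congr `| _ |; ring.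
Qed.

(** The difference [g - f] satisfies the straddling condition: the errors on the two sides of [u]
    add up to [e * (t - s)], and the linear terms have the right sign. No regularity of the
    derivatives is required. *)
Lemma deriv_on_le a b f g f' g' : a <= b ->
  deriv_on a b f f' -> deriv_on a b g g' ->
  (forall u, a <= u <= b -> f' u <= g' u) -> f b - f a <= g b - g a.
Proof.
move=> ab Hf Hg fg.
suff : g a - f a <= g b - f b by lra.
apply: (@nondecreasing_straddle a b (fun u => g u - f u)) => // u uab e e0.
have [d d0 Hd] := deriv_onB Hg Hf uab e0; exists d => // s t /andP[as_ su] /andP[ut tb] std.
have := Hd t; have := Hd s.
have -> : `|s - u| = u - s by rewrite distrC ger0_norm // subr_ge0.
have -> : `|t - u| = t - u by rewrite ger0_norm // subr_ge0.
move=> /(_ _ _)/ler_normlP[||H1 H1']; [lra|lra|].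
move=> /(_ _ _)/ler_normlP[||H2 H2']; [lra|lra|].
have P1 := fg u uab.
have Q1 : 0 <= (g' u - f' u) * (t - u) by apply: mulr_ge0; lra.
have Q2 : 0 <= (g' u - f' u) * (u - s) by apply: mulr_ge0; lra.
lra.
Qed.

(* The increment of [phi] over [lo, hi] splits at x0; the two pieces are
   bounded by [Gam (hi - x0)] and [Gam (x0 - lo)], and [Gam] is superadditive
   because its derivative is nondecreasing. *)
Lemma growth_le (lo hi x0 : R) (gam Gam phi phi' : R -> R) :
  deriv_on 0 1 Gam gam -> Gam 0 = 0 ->
  (forall u v, 0 <= u <= v -> v <= 1 -> gam u <= gam v) ->
  lo <= x0 <= hi -> hi - lo <= 1 -> deriv_on lo hi phi phi' ->
  (forall u, lo <= u <= hi -> phi' u <= gam `|u - x0|) ->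
  phi hi - phi lo <= Gam (hi - lo).
Proof.
move=> dG G0 gm /andP[lx xh] hl dphi bnd.
have H1 : phi hi - phi x0 <= Gam (hi - x0).
  have := @deriv_on_le x0 hi phi (fun u => Gam (u + - x0)) phi'
    (fun u => gam (u + - x0)) xh.
  rewrite subrr G0 subr0; apply.
  - by apply: deriv_on_sub dphi.
  - by apply/deriv_on_shift/(deriv_on_sub _ _ dG); lra.
  - move=> u /andP[xu uh]; have := bnd u; rewrite ger0_norm; last lra.
    by apply; lra.
have H2 : phi x0 - phi lo <= Gam (x0 - lo).
  have := @deriv_on_le lo x0 phi (fun u => - Gam (x0 - u)) phi'
    (fun u => gam (x0 - u)) lx.
  rewrite subrr G0 oppr0 sub0r opprK; apply.
  - by apply: deriv_on_sub dphi.
  - by apply/deriv_on_reflect/(deriv_on_sub _ _ dG); lra.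
  - move=> u /andP[xu uh]; have := bnd u; rewrite distrC ger0_norm; last lra.
    by apply; lra.
have H3 : Gam (hi - x0) - Gam 0 <= Gam (hi - x0 + (x0 - lo)) - Gam (0 + (x0 - lo)).
  apply: (@deriv_on_le 0 (hi - x0) Gam (fun u => Gam (u + (x0 - lo))) gam
    (fun u => gam (u + (x0 - lo)))).
  - lra.
  - by apply: deriv_on_sub dG; lra.
  - by apply/deriv_on_shift/(deriv_on_sub _ _ dG); lra.
  - by move=> u /andP[u0 uh]; apply: gm; lra.
have E : hi - x0 + (x0 - lo) = hi - lo by ring.
rewrite E G0 add0r in H3; lra.
Qed.

(** The one-sided growth bound is applied to [phi u - c * u] and to its opposite. *)
Lemma growth_norm_le (lo hi x0 c : R) (gam Gam phi phi' : R -> R) :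
  deriv_on 0 1 Gam gam -> Gam 0 = 0 ->
  (forall u v, 0 <= u <= v -> v <= 1 -> gam u <= gam v) ->
  lo <= x0 <= hi -> hi - lo <= 1 -> deriv_on lo hi phi phi' ->
  (forall u, lo <= u <= hi -> `|phi' u - c| <= gam `|u - x0|) ->
  `|phi hi - phi lo - c * (hi - lo)| <= Gam (hi - lo).
Proof.
move=> dG G0 gm x0lh hl dphi bnd.
have dp := deriv_onB dphi (@deriv_on_mulr lo hi c).
have H1 := growth_le dG G0 gm x0lh hl dp.
have H2 := growth_le dG G0 gm x0lh hl (deriv_onN dp).
apply/ler_normlP; split.
- have /H2 : forall u, lo <= u <= hi -> - (phi' u - c) <= gam `|u - x0|.
    by move=> u /bnd/ler_normlP[].
  by lra.
- have /H1 : forall u, lo <= u <= hi -> phi' u - c <= gam `|u - x0|.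
    by move=> u /bnd/ler_normlP[].
  by lra.
Qed.

Lemma deriv0_on_eq f : deriv_on 0 1 f (fun=> 0) ->
  forall t, 0 <= t <= 1 -> f t = f 0.
Proof.
move=> df t t01; have d0 := @deriv_on_mulr 0 1 0.
have dft : deriv_on 0 t f (fun=> 0) by apply: deriv_on_sub df; lra.
have d0t : deriv_on 0 t (fun u => 0 * u) (fun=> 0) by apply: deriv_on_sub d0; lra.
have t0 : 0 <= t by lra.
have := deriv_on_le t0 dft d0t; have := deriv_on_le t0 d0t dft.
by move=> /(_ (fun _ _ => lexx _)) ? /(_ (fun _ _ => lexx _)) ?; lra.
Qed.

(** * Primitives of uniformly continuous functions on the unit interval *)

Definition ucont01 f := forall e, 0 < e -> exists2 d, 0 < d &
  forall s t, 0 <= s <= 1 -> 0 <= t <= 1 -> `|s - t| < d -> `|f s - f t| <= e.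

Local Notation mu := (@lebesgue_measure R).

Definition int0 f t : R := \int[mu]_(u in `[0, t]) f u.

Lemma ucont01_integrable f a b : 0 <= a -> b <= 1 -> ucont01 f ->
  mu.-integrable `[a, b] (EFin \o f).
Proof.
move=> a0 b1 cf; apply: continuous_compact_integrable; first exact: segment_compact.
apply/subspace_continuousP => x /=; rewrite in_itv/= => xab.
apply/cvgrPdist_le => e e0; have [d d0 Hd] := cf e e0.
exists d => // y xy; rewrite /= in_itv/= => yab.
by apply: Hd => //; lra.
Qed.

Lemma int0_0 f : int0 f 0 = 0.
Proof. by rewrite /int0 set_itv1 Rintegral_set1. Qed.

Lemma le_int0 f g t : 0 <= t <= 1 -> ucont01 f -> ucont01 g ->
  (forall u, 0 <= u <= t -> f u <= g u) -> int0 f t <= int0 g t.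
Proof.
move=> /andP[t0 t1] cf cg fg; apply: le_Rintegral => //.
- exact: ucont01_integrable.
- exact: ucont01_integrable.
Qed.

Lemma int0B f g t : 0 <= t <= 1 -> ucont01 f -> ucont01 g ->
  int0 (fun u => f u - g u) t = int0 f t - int0 g t.
Proof.
by move=> /andP[t0 t1] cf cg; apply: RintegralB => //; apply: ucont01_integrable.
Qed.

Lemma int0Zl f c t : 0 <= t <= 1 -> ucont01 f ->
  int0 (fun u => c * f u) t = c * int0 f t.
Proof.
by move=> /andP[t0 t1] cf; apply: RintegralZl => //; apply: ucont01_integrable.
Qed.

Lemma eq_int0 f g t : (forall u, 0 <= u <= t -> f u = g u) -> int0 f t = int0 g t.
Proof.
by move=> fg; apply: eq_Rintegral => u; rewrite inE/= in_itv/= => /fg.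
Qed.

Lemma EFin_int0 f t : 0 <= t <= 1 -> ucont01 f ->
  ((int0 f t)%:E = \int[mu]_(u in `[0%R, t]) (f u)%:E)%E.
Proof.
move=> /andP[t0 t1] cf; rewrite /int0 /Rintegral fineK //.
by apply: integrable_fin_num => //; apply: ucont01_integrable.
Qed.

Lemma ucont01_cst c : ucont01 (fun=> c).
Proof. by move=> e e0; exists 1 => // s t _ _ _; rewrite subrr normr0 ltW. Qed.

Lemma ucont01B f g : ucont01 f -> ucont01 g -> ucont01 (fun u => f u - g u).
Proof.
move=> cf cg e e0; have e2 : 0 < e / 2 by lra.
have [r r0 Hr] := cf _ e2; have [s s0 Hs] := cg _ e2.
exists (Num.min r s) => [|u v u01 v01]; first by rewrite lt_min r0 s0.
rewrite lt_min => /andP[/(Hr _ _ u01 v01) H1 /(Hs _ _ u01 v01) H2].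
have -> : f u - g u - (f v - g v) = (f u - f v) - (g u - g v) by ring.
by apply: le_trans (ler_normB _ _) _; lra.
Qed.

Lemma ucont01Zl c f : ucont01 f -> ucont01 (fun u => c * f u).
Proof.
move=> cf e e0; have c0 : 0 < `|c| + 1 by have := normr_ge0 c; lra.
have [d d0 Hd] := cf _ (divr_gt0 e0 c0); exists d => // s t s01 t01 st.
have := Hd s t s01 t01 st; rewrite ler_pdivlMr // => H.
rewrite -mulrBr normrM mulrC; apply: le_trans H.
by apply: ler_wpM2l => //; lra.
Qed.

Lemma int0_cst c t : 0 <= t -> int0 (fun=> c) t = c * t.
Proof.
move=> t0; rewrite /int0 Rintegral_cst //= lebesgue_measure_itv /= lte_fin.
by case: ltgtP t0 => // [t0 _|<- _]; rewrite -?EFinB /= ?subr0.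
Qed.

Lemma norm_int0_le f t c : 0 <= t <= 1 -> ucont01 f ->
  (forall u, 0 <= u <= t -> `|f u| <= c) -> `|int0 f t| <= c * t.
Proof.
move=> t01 cf fc; have /andP[t0 t1] := t01; apply/ler_normlP; split; last first.
  rewrite -int0_cst //; apply: le_int0 => //; first exact: ucont01_cst.
  by move=> u /fc /ler_normlP[].
suff : int0 (fun=> - c) t <= int0 f t by rewrite int0_cst //; lra.
apply: le_int0 => //; first exact: ucont01_cst.
by move=> u /fc /ler_normlP[]; lra.
Qed.

Lemma int0_increment_le f s t c : 0 <= s <= t -> t <= 1 -> ucont01 f ->
  (forall u, s <= u <= t -> f u <= c) -> int0 f t - int0 f s <= c * (t - s).
Proof.
move=> /andP[s0 st] t1 cf fc.
have i0t : mu.-integrable `[0, t] (EFin \o f) by exact: ucont01_integrable.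
rewrite /int0 Rintegral_itvB ?bnd_simp //.
rewrite Rintegral_itv_obnd_cbnd; last first.
  by apply: integrableS i0t => //; apply: subset_itv; rewrite ?bnd_simp.
have -> : c * (t - s) = \int[mu]_(u in `[s, t]) (fun=> c) u.
  rewrite Rintegral_cst //= lebesgue_measure_itv /= lte_fin.
  by move: st; rewrite le_eqVlt => /predU1P[->|->]; rewrite ?ltxx ?subrr // -EFinB.
apply: le_Rintegral => //; first exact: ucont01_integrable.
by apply: ucont01_integrable => //; exact: ucont01_cst.
Qed.

(** Serves two purposes: with [c] the value of the integrand at [s] it differentiates the primitive,
    and with [c = 0] it shows that the primitive is Lipschitz. *)
Lemma int0_increment_norm_le f s t c e :
  0 <= s <= 1 -> 0 <= t <= 1 -> ucont01 f ->
  (forall u, 0 <= u <= 1 -> `|u - s| <= `|t - s| -> `|f u - c| <= e) ->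
  `|int0 f t - int0 f s - c * (t - s)| <= e * `|t - s|.
Proof.
move=> s01 t01 cf H.
(* The lower bounds come from the upper bound for the opposite function, written as a scalar
   multiple so that linearity of the integral applies. *)
have Hn : ucont01 (fun u => - 1 * f u) by exact: ucont01Zl.
have [st|ts] := leP s t.
- have ub u : s <= u <= t -> - e <= f u - c <= e.
    move=> /andP[su ut]; rewrite -ler_norml; apply: H; first lra.
    by rewrite !ger0_norm; lra.
  have sst : 0 <= s <= t by lra.
  have t1 : t <= 1 by lra.
  have U := @int0_increment_le f s t (c + e) sst t1 cf.
  have L := @int0_increment_le _ s t (- c + e) sst t1 Hn.
  rewrite !int0Zl // in L; rewrite ler_norml ger0_norm ?subr_ge0 //.
  have /U {}U : forall u, s <= u <= t -> f u <= c + e by move=> u /ub; lra.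
  have /L {}L : forall u, s <= u <= t -> - 1 * f u <= - c + e by move=> u /ub; lra.
  by apply/andP; split; lra.
- have ub u : t <= u <= s -> - e <= f u - c <= e.
    move=> /andP[su ut]; rewrite -ler_norml; apply: H; first lra.
    by rewrite !ler0_norm; lra.
  have sst : 0 <= t <= s by lra.
  have t1 : s <= 1 by lra.
  have U := @int0_increment_le f t s (c + e) sst t1 cf.
  have L := @int0_increment_le _ t s (- c + e) sst t1 Hn.
  rewrite !int0Zl // in L.
  have -> : `|t - s| = s - t by rewrite distrC ger0_norm // subr_ge0 ltW.
  rewrite ler_norml.
  have /U {}U : forall u, t <= u <= s -> f u <= c + e by move=> u /ub; lra.
  have /L {}L : forall u, t <= u <= s -> - 1 * f u <= - c + e by move=> u /ub; lra.
  by apply/andP; split; lra.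
Qed.

End one_variable.

(** * Partial derivatives on the cube *)

Section partial_derivatives.
Context {R : realType} {n : nat}.
Implicit Types (x y z : 'rV[R]_n) (i k : 'I_n) (f g : 'rV[R]_n -> R).
Implicit Types (u v : R).
Local Notation cube := (@unit_cube R n).

Lemma set_coordE x i u k : set_coord x i u 0 k = if k == i then u else x 0 k.
Proof. by rewrite mxE. Qed.

Lemma set_coord_eq x i u : set_coord x i u 0 i = u.
Proof. by rewrite set_coordE eqxx. Qed.

Lemma set_coord_neq x i k u : k != i -> set_coord x i u 0 k = x 0 k.
Proof. by rewrite set_coordE => /negbTE ->. Qed.

Lemma set_coord_id x i : set_coord x i (x 0 i) = x.
Proof. by apply/rowP => k; rewrite set_coordE; case: eqP => [->|]. Qed.

Lemma set_coordK x i u v : set_coord (set_coord x i u) i v = set_coord x i v.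
Proof. by apply/rowP => k; rewrite !set_coordE; case: eqP. Qed.

Lemma set_coordC x i k u v : i != k ->
  set_coord (set_coord x i u) k v = set_coord (set_coord x k v) i u.
Proof.
move=> ik; apply/rowP => j; rewrite !set_coordE.
by have [->|//] := eqVneq j k; rewrite eq_sym (negbTE ik).
Qed.

Lemma set_coord_cube x i u : cube x -> 0 <= u <= 1 -> cube (set_coord x i u).
Proof. by move=> xc u01 k; rewrite set_coordE; case: eqP. Qed.

Lemma addr_delta_mx x i u : x + u *: delta_mx 0 i = set_coord x i (x 0 i + u).
Proof.
apply/rowP => k; rewrite !mxE eqxx /= [k == i]eq_sym.
by case: eqP => [->|_] /=; rewrite ?mulr1 ?mulr0 ?addr0 // addrC.
Qed.

(** The division-free form of convergence of the difference quotient to [l], matching [deriv_on] on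
    lines parallel to the [i]-th axis. *)
Definition pderiv (A : set 'rV[R]_n) i f x (l : R) := forall e, 0 < e ->
  exists2 d, 0 < d & forall v, A (set_coord x i v) -> `|v - x 0 i| < d ->
    `|f (set_coord x i v) - f x - l * (v - x 0 i)| <= e * `|v - x 0 i|.

Lemma diff_quotient_cvgP A i f x l :
  (diff_quotient A i f x --> l) <-> pderiv A i f x l.
Proof.
split=> [/cvgrPdist_le H e e0|H].
- have [d /= d0 Hd] := H e e0; exists d => // v Av vd.
  have [->|vx] := eqVneq v (x 0 i).
    by rewrite set_coord_id !subrr mulr0 subr0 normr0 mulr0.
  have h0 : v - x 0 i != 0 by rewrite subr_eq0.
  have := Hd (v - x 0 i); rewrite /= sub0r normrN => /(_ vd h0).
  rewrite !addr_delta_mx subrKC => /(_ Av) Hl.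
  have -> : f (set_coord x i v) - f x - l * (v - x 0 i) =
      - (l - (v - x 0 i)^-1 * (f (set_coord x i v) - f x)) * (v - x 0 i).
    by rewrite mulNr mulrBl mulrAC mulVf // mul1r opprB addrC.
  by rewrite normrM normrN; apply: ler_wpM2r.
- apply/cvgrPdist_le => e e0; have [d d0 Hd] := H e e0.
  exists d => // h /=; rewrite sub0r normrN => hd h0.
  rewrite addr_delta_mx => Ah; have := Hd _ Ah.
  rewrite addrAC subrr add0r => /(_ hd) {}Hd.
  have hn : 0 < `|h| by rewrite normr_gt0.
  rewrite -(ler_pM2r hn) -normrM.
  apply: le_trans Hd; rewrite -normrN le_eqVlt; apply/orP; left; apply/eqP.
  by congr `| _ |; field.
Qed.

(** Limits are unique only along a proper filter, so the value of [partial] can be computed only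
    where nonzero admissible increments accumulate at 0. *)
Lemma within_dnbhs_proper (A : set 'rV[R]_n) i x :
  (forall d, 0 < d -> exists2 h, h != 0 /\ `|h| < d & A (set_coord x i (x 0 i + h))) ->
  ProperFilter (within [set h : R | A (x + h *: delta_mx 0 i)] 0^').
Proof.
move=> H; apply: Build_ProperFilter_ex => P [d /= d0 Hd].
have [h [h0 hd] Ah] := H d d0; exists h.
by apply: Hd => //=; rewrite ?sub0r ?normrN // addr_delta_mx.
Qed.

Lemma cube_accumulation x i : cube x -> forall d, 0 < d ->
  exists2 h, h != 0 /\ `|h| < d & cube (set_coord x i (x 0 i + h)).
Proof.
move=> xc d d0; have /andP[x0 x1] := xc i.
have m0 : 0 < Num.min (d / 2) (1 / 2) by rewrite lt_min; apply/andP; split; lra.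
have m1 : Num.min (d / 2) (1 / 2) <= d / 2 by rewrite ge_min lexx.
have m2 : Num.min (d / 2) (1 / 2) <= 1 / 2 by rewrite ge_min lexx orbT.
(* The increment points away from the nearer face; its size is at most 1/2, so it stays in the
   cube. *)
have [xh|xh] := leP (x 0 i) (1 / 2).
- exists (Num.min (d / 2) (1 / 2)); first by rewrite gt_eqF // gtr0_norm //; split => //; lra.
  by apply: set_coord_cube => //; lra.
- exists (- Num.min (d / 2) (1 / 2)).
    by rewrite oppr_eq0 normrN gt_eqF // gtr0_norm //; split => //; lra.
  by apply: set_coord_cube => //; lra.
Qed.

Lemma setT_accumulation x i : forall d, 0 < d ->
  exists2 h, h != 0 /\ `|h| < d & setT (set_coord x i (x 0 i + h)).
Proof.
move=> d d0; exists (d / 2) => //; rewrite gt_eqF ?gtr0_norm; last lra; first by split=> //; lra.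
lra.
Qed.

Lemma has_partial_pderiv A i f x : has_partial A i f -> A x ->
  pderiv A i f x (partial A i f x).
Proof. by move=> fi Ax; apply/diff_quotient_cvgP/fi. Qed.

Lemma pderiv_has_partial (A : set 'rV[R]_n) i f f' :
  (forall x, A x -> pderiv A i f x (f' x)) -> has_partial A i f.
Proof.
move=> H x Ax; have /diff_quotient_cvgP H1 := H x Ax.
by apply/cvg_ex; exists (f' x).
Qed.

Lemma pderiv_partial A i f x l :
  (forall d, 0 < d -> exists2 h, h != 0 /\ `|h| < d & A (set_coord x i (x 0 i + h))) ->
  pderiv A i f x l -> partial A i f x = l.
Proof.
move=> acc /diff_quotient_cvgP fl.
have PF := within_dnbhs_proper acc.
by apply: cvg_lim fl; exact: Rhausdorff.
Qed.

Lemma pderiv_partial_cube i f x l : cube x ->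
  pderiv cube i f x l -> partial cube i f x = l.
Proof. by move=> xc; apply: pderiv_partial; exact: cube_accumulation. Qed.

Lemma eq_pderiv_cube i f g x l : (forall y, cube y -> f y = g y) -> cube x ->
  pderiv cube i f x l -> pderiv cube i g x l.
Proof.
move=> fg xc H e e0; have [d d0 Hd] := H e e0; exists d => // v vc vd.
by rewrite -!fg //; apply: Hd.
Qed.

Lemma eq_partial_cube i f g x : has_partial cube i f ->
  (forall y, cube y -> f y = g y) -> cube x -> partial cube i f x = partial cube i g x.
Proof.
move=> hf fg xc; apply/esym/pderiv_partial_cube => //.
by apply: (eq_pderiv_cube fg) => //; exact: has_partial_pderiv.
Qed.

Lemma eq_has_partial_cube i f g :
  (forall y, cube y -> f y = g y) -> has_partial cube i f -> has_partial cube i g.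
Proof.
move=> fg hf; apply: pderiv_has_partial => x xc.
by apply: (eq_pderiv_cube fg) => //; exact: has_partial_pderiv.
Qed.

Lemma pderiv_section i f f' x : cube x ->
  (forall y, cube y -> pderiv cube i f y (f' y)) ->
  deriv_on 0 1 (fun v => f (set_coord x i v)) (fun v => f' (set_coord x i v)).
Proof.
move=> xc H u u01 e e0; have [d d0 Hd] := H _ (set_coord_cube i xc u01) e e0.
exists d => // v v01; move: (Hd v); rewrite !set_coordK set_coord_eq.
by apply; exact: set_coord_cube.
Qed.

Lemma section_deriv_cube i f x : cube x -> has_partial cube i f ->
  deriv_on 0 1 (fun v => f (set_coord x i v))
               (fun v => partial cube i f (set_coord x i v)).
Proof. by move=> xc hf; apply: pderiv_section => // y; exact: has_partial_pderiv. Qed.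

End partial_derivatives.

(** * Partial integrals *)

Section partial_integrals.
Context {R : realType} {n : nat}.
Implicit Types (x y z : 'rV[R]_n) (i k : 'I_n) (f g F G : 'rV[R]_n -> R).
Implicit Types (u v : R) (s : seq 'I_n).
Local Notation cube := (@unit_cube R n).

(** Boundedness is carried along with uniform continuity because it is what makes partial primitives
    Lipschitz in their own variable; the class is thereby stable under [pint]. *)
Definition ucube F := (exists C, forall x, cube x -> `|F x| <= C) /\
  forall e, 0 < e -> exists2 d, 0 < d & forall x y, cube x -> cube y ->
    (forall k, `|x 0 k - y 0 k| < d) -> `|F x - F y| <= e.

Lemma ucube_section i F x : cube x -> ucube F ->
  ucont01 (fun u => F (set_coord x i u)).
Proof.
move=> xc [_ H] e e0; have [d d0 Hd] := H e e0; exists d => // u v u01 v01 uv.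
apply: Hd; [exact: set_coord_cube|exact: set_coord_cube|] => k.
by rewrite !set_coordE; case: eqP => // _; rewrite subrr normr0.
Qed.

(** The primitive in the [i]-th variable that vanishes on the face [x 0 i = 0]. *)
Definition pint i F x := int0 (fun u => F (set_coord x i u)) (x 0 i).

Lemma pintE i F x : pint i F x = int0 (fun u => F (set_coord x i u)) (x 0 i).
Proof. by []. Qed.

Lemma pint_set_coord i F x v :
  pint i F (set_coord x i v) = int0 (fun u => F (set_coord x i u)) v.
Proof.
rewrite /pint set_coord_eq; congr int0.
by apply/funext => u; rewrite set_coordK.
Qed.

Lemma pint0 i F x : x 0 i = 0 -> pint i F x = 0.
Proof. by rewrite /pint => ->; rewrite int0_0. Qed.

Lemma eq_pint i F G x : cube x -> (forall y, cube y -> F y = G y) ->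
  pint i F x = pint i G x.
Proof.
move=> xc FG; apply: eq_int0 => u uxi; apply/FG/set_coord_cube => //.
by have := xc i; lra.
Qed.

Lemma ucube_pint i F : ucube F -> ucube (pint i F).
Proof.
move=> uF; have [[C HC] Hu] := uF; split.
  exists C => x xc; have xi := xc i; apply: (@le_trans _ _ (C * x 0 i)).
    apply: norm_int0_le => // [|u u0]; first exact: ucube_section.
    by apply/HC/set_coord_cube => //; lra.
  have C0 : 0 <= C by apply: le_trans (normr_ge0 _) (HC x xc).
  by have := ler_wpM2l C0 (_ : x 0 i <= 1); rewrite mulr1; apply; lra.
move=> e e0; have e2 : 0 < e / 2 by lra.
have [d d0 Hd] := Hu _ e2.
have C1 : 0 < `|C| + 1 by have := normr_ge0 C; lra.
(* Half of [e] pays for the change of integrand, half for the change of upper limit; the latter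
   costs at most [C] per unit length, and adding 1 keeps the divisor positive. *)
have d1 : 0 < e / 2 / (`|C| + 1) by exact: divr_gt0.
exists (Num.min d (e / 2 / (`|C| + 1))) => [|x y xc yc H]; first by rewrite lt_min d0 d1.
have xi := xc i; have yi := yc i.
have cx := ucube_section i xc uF; have cy := ucube_section i yc uF.
rewrite /pint; set fx := fun u => F (set_coord x i u); set fy := fun u => F (set_coord y i u).
have H1 : `|int0 fx (x 0 i) - int0 fy (x 0 i)| <= e / 2.
  rewrite -int0B //; apply: (@le_trans _ _ (e / 2 * x 0 i)).
    apply: norm_int0_le => // [|u u0]; first exact: ucont01B.
    have u1 : 0 <= u <= 1 by lra.
    apply: Hd; [exact: set_coord_cube|exact: set_coord_cube|] => k.
    rewrite !set_coordE; case: eqP => _; first by rewrite subrr normr0.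
    by have := H k; rewrite lt_min => /andP[].
  by have := ler_wpM2l (ltW e2) (_ : x 0 i <= 1); rewrite mulr1; apply; lra.
have H2 : `|int0 fy (x 0 i) - int0 fy (y 0 i)| <= e / 2.
  have := int0_increment_norm_le (c := 0) (e := C) yi xi cy.
  rewrite mul0r subr0 => IH; apply: le_trans (IH _) _ => [u u01 _|].
    by rewrite subr0; apply/HC/set_coord_cube.
  have := H i; rewrite lt_min => /andP[_]; rewrite ltr_pdivlMr // => Hi.
  have := ler_wpM2r (normr_ge0 (x 0 i - y 0 i)) (ler_norm C).
  have := normr_ge0 (x 0 i - y 0 i); nra.
have -> : int0 fx (x 0 i) - int0 fy (y 0 i) =
  (int0 fx (x 0 i) - int0 fy (x 0 i)) + (int0 fy (x 0 i) - int0 fy (y 0 i)) by ring.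
by apply: le_trans (ler_normD _ _) _; lra.
Qed.

(** The radius [d] is the same for all [x], which is what permits integrating this estimate in
    another variable. *)
Lemma ucube_increment i F e : ucube F -> 0 < e -> exists2 d, 0 < d &
  forall x v, cube x -> 0 <= v <= 1 -> `|v - x 0 i| < d ->
   `|pint i F (set_coord x i v) - pint i F x - F x * (v - x 0 i)| <= e * `|v - x 0 i|.
Proof.
move=> uF e0; have [d d0 Hd] := uF.2 e e0; exists d => // x v xc v01 vd.
rewrite pint_set_coord; apply: int0_increment_norm_le => //.
  exact: ucube_section.
move=> u u01 uv; rewrite -{2}(set_coord_id x i).
apply: Hd; [exact: set_coord_cube|by rewrite set_coord_id|] => k.
rewrite !set_coordE; case: eqP => [_|_]; last by rewrite subrr normr0.
exact: le_lt_trans uv vd.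
Qed.

Lemma pderiv_pint i F x : ucube F -> cube x -> pderiv cube i (pint i F) x (F x).
Proof.
move=> uF xc e e0; have [d d0 Hd] := ucube_increment i uF e0; exists d => // v vc vd.
by apply: Hd => //; have := vc i; rewrite set_coord_eq.
Qed.

(** Differentiation under the integral sign, by integrating the uniform estimate of
    [ucube_increment] in the variable [k]. *)
Lemma pderiv_pint_pint i k F x : i != k -> ucube F -> cube x ->
  pderiv cube i (pint k (pint i F)) x (pint k F x).
Proof.
move=> ik uF xc e e0; have [d d0 Hd] := ucube_increment i uF e0; exists d => // v vc vd.
have v01 : 0 <= v <= 1 by have := vc i; rewrite set_coord_eq.
have ki : k != i by rewrite eq_sym.
have xk := xc k; have uI := ucube_pint i uF.
rewrite !(pintE k) set_coord_neq // [_ * (v - _)]mulrC.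
have c1 := ucube_section k (set_coord_cube i xc v01) uI.
have c2 := ucube_section k xc uI; have c3 := ucube_section k xc uF.
rewrite -int0Zl // -int0B // -int0B //; last 2 first.
- exact: ucont01B.
- exact: ucont01Zl.
apply: (@le_trans _ _ (e * `|v - x 0 i| * x 0 k)).
  apply: norm_int0_le => // [|u u0].
    by apply: ucont01B; [exact: ucont01B | exact: ucont01Zl].
  have := Hd (set_coord x k u) v; rewrite set_coord_neq // (set_coordC _ _ _ ki).
  rewrite [F _ * _]mulrC; apply => //.
  by apply: set_coord_cube => //; lra.
have p : 0 <= e * `|v - x 0 i| by rewrite mulr_ge0 // ltW.
by have := ler_wpM2l p (_ : x 0 k <= 1); rewrite mulr1; apply; lra.
Qed.

Lemma pderivB A i f g x l l' : pderiv A i f x l -> pderiv A i g x l' ->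
  pderiv A i (fun y => f y - g y) x (l - l').
Proof.
move=> Hf Hg e e0; have e2 : 0 < e / 2 by lra.
have [r r0 Hr] := Hf _ e2; have [s s0 Hs] := Hg _ e2.
exists (Num.min r s) => [|v vA]; first by rewrite lt_min r0 s0.
rewrite lt_min => /andP[/(Hr v vA) H1 /(Hs v vA) H2].
set fv := f (set_coord x i v) in H1 *; set gv := g (set_coord x i v) in H2 *.
have -> : fv - gv - (f x - g x) - (l - l') * (v - x 0 i) =
  (fv - f x - l * (v - x 0 i)) - (gv - g x - l' * (v - x 0 i)) by ring.
by apply: le_trans (ler_normB _ _) _; lra.
Qed.

(** Both sides have the same derivative [pint k F] in the variable [i] and both vanish where that
    variable is 0. This gives the exchange of integrals without a product measure. *)
Lemma pintC i k F x : ucube F -> cube x -> pint i (pint k F) x = pint k (pint i F) x.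
Proof.
move=> uF xc; have [->//|ik] := eqVneq i k.
pose D y := pint i (pint k F) y - pint k (pint i F) y.
suff : D x = 0 by move/eqP; rewrite subr_eq0 => /eqP.
have HD y : cube y -> pderiv cube i D y 0.
  move=> yc; have := pderivB (pderiv_pint i (ucube_pint k uF) yc) (pderiv_pint_pint ik uF yc).
  by rewrite subrr.
have := deriv0_on_eq (pderiv_section xc HD) (xc i); rewrite set_coord_id => ->.
rewrite /D pint0 ?set_coord_eq // sub0r; apply/eqP; rewrite oppr_eq0; apply/eqP.
rewrite {1}/pint (eq_int0 (g := fun=> 0)) => [|u u0].
  by rewrite int0_cst ?mul0r // set_coord_neq 1?eq_sym //; have := xc k; lra.
by rewrite pint0 // set_coord_neq // set_coord_eq.
Qed.

Definition pints s F := foldr pint F s.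

Lemma ucube_pints s F : ucube F -> ucube (pints s F).
Proof. by move=> uF; elim: s => //= i s; exact: ucube_pint. Qed.

Lemma perm_pints s s' F x : ucube F -> cube x -> perm_eq s s' ->
  pints s F x = pints s' F x.
Proof.
move=> uF; elim: s s' x => [|i s IHs] s' x xc.
  by move/perm_size/esym/size0nil ->.
move=> is'; have si : i \in s' by rewrite -(perm_mem is') mem_head.
case/splitPr: si is' => a b is'.
have sab : perm_eq s (a ++ b).
  by rewrite -(perm_cons i) (perm_trans is') // -[i :: b]cat1s perm_catCA.
transitivity (pints (i :: a ++ b) F x).
  by apply: eq_pint => // y yc; exact: IHs.
elim: a x xc {is' sab IHs} => //= k a IHa x xc.
rewrite -(eq_pint k xc IHa) /= pintC //.
exact: ucube_pints.
Qed.

(** Since partial primitives commute, the integral in the variable about to be differentiated can be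
    made the outermost one, and the derivative cancels it. *)
Lemma partials_pints s s' t F : ucube F -> perm_eq s (t ++ s') ->
  has_partials cube t (pints s F) /\
  forall x, cube x -> partials cube t (pints s F) x = pints s' F x.
Proof.
move=> uF; elim: t s' => [|i t IHt] s' st /=.
  by split=> // x xc; exact: perm_pints.
have [|hp eqp] := IHt (i :: s').
  by rewrite (perm_trans st) //= perm_sym -[i :: s']cat1s perm_catCA.
have uI : ucube (pints s' F) by exact: ucube_pints.
have hI : has_partial cube i (pints (i :: s') F).
  by apply: pderiv_has_partial => x; exact: pderiv_pint.
have eqp' y : cube y -> pints (i :: s') F y = partials cube t (pints s F) y.
  by move=> yc; rewrite eqp.
split; first by split=> //; exact: eq_has_partial_cube eqp' hI.
move=> x xc; rewrite -(eq_partial_cube hI eqp' xc).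
by apply: pderiv_partial_cube => //; exact: pderiv_pint.
Qed.

Lemma pints_eq0 s F x : (exists2 i, i \in s & x 0 i = 0) -> uniq s -> ucube F ->
  cube x -> pints s F x = 0.
Proof.
move=> [i si xi] us uF xc; rewrite (@perm_pints _ (i :: rem i s)) //.
  by rewrite /= pint0.
exact: perm_to_rem.
Qed.

Definition set_coords s (b : 'I_n -> R) x : 'rV[R]_n :=
  \row_k if k \in s then b k else x 0 k.

Lemma set_coords_nil b x : set_coords [::] b x = x.
Proof. by apply/rowP => k; rewrite mxE. Qed.

Lemma set_coords_cons i s b x :
  set_coords (i :: s) b x = set_coord (set_coords s b x) i (b i).
Proof. by apply/rowP => k; rewrite !mxE inE; case: eqP => [->|]. Qed.

Lemma set_coord_set_coords i s b x u : i \notin s ->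
  set_coord (set_coords s b x) i u = set_coords s b (set_coord x i u).
Proof.
move=> si; apply/rowP => k; rewrite !mxE.
by case: eqP => [->|//]; rewrite (negbTE si).
Qed.

Lemma set_coords_cube s b x : cube x -> (forall i, i \in s -> 0 <= b i <= 1) ->
  cube (set_coords s b x).
Proof. by move=> xc bs k; rewrite mxE; case: ifP => // /bs. Qed.

Lemma pints_set_coord i s G u : i \notin s -> 
  pints s (fun x => G (set_coord x i u)) = (fun x => pints s G (set_coord x i u)).
Proof.
elim: s => [//|k s IHs]; rewrite inE negb_or => /andP[ik /IHs /= ->].
apply/funext => x; rewrite /pint set_coord_neq 1?eq_sym //; congr int0.
by apply/funext => v; rewrite set_coordC // eq_sym.
Qed.

(** Links the two descriptions of a box integral: iterated primitives evaluated at the upper corner,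
    and iterated Lebesgue integrals with values in the extended reals. *)
Lemma EFin_pints s (b : 'I_n -> R) G (H : 'rV[R]_n -> \bar R) x :
  uniq s -> ucube G -> cube x -> (forall i, i \in s -> 0 <= b i <= 1) ->
  (forall y, cube y -> (G y)%:E = H y) ->
  (pints s G (set_coords s b x))%:E =
  foldr (fun i (K : 'rV[R]_n -> \bar R) y =>
      (\int[lebesgue_measure]_(u in `[0%R, b i]) K (set_coord y i u))%E) H s x.
Proof.
move=> + uG + + GH; elim: s x => [|i s IHs] x /=.
  by move=> _ xc _; rewrite set_coords_nil GH.
move=> /andP[si us] xc bs; have bi := bs i (mem_head _ _).
have bs' k : k \in s -> 0 <= b k <= 1 by move=> ks; apply: bs; rewrite inE ks orbT.
rewrite set_coords_cons pint_set_coord EFin_int0 //; last first.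
  by apply: ucube_section; [exact: set_coords_cube | exact: ucube_pints].
apply: eq_integral => u; rewrite inE /= in_itv /= => ub.
rewrite set_coord_set_coords // IHs //; apply: set_coord_cube => //; lra.
Qed.

Lemma eq_pints_on s F G x : (forall z, (forall k, k \notin s -> z 0 k = x 0 k) -> F z = G z) ->
  pints s F x = pints s G x.
Proof.
elim: s F G x => [|i s IHs] F G x /= FG; first by apply: FG.
apply: eq_int0 => u _; apply: IHs => z zx; apply: FG => k; rewrite inE negb_or => /andP[ki ks].
by rewrite zx // set_coord_neq.
Qed.

Lemma eq_pints_coords (P : pred 'I_n) s G y z :
  (forall y z, (forall k, P k -> y 0 k = z 0 k) -> G y = G z) ->
  {subset s <= P} -> (forall k, P k -> y 0 k = z 0 k) -> pints s G y = pints s G z.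
Proof.
move=> GP; elim: s y z => [|i s IHs] y z sP yz /=; first exact: GP.
have Pi : P i by apply: sP; rewrite mem_head.
rewrite /pint yz //; apply: eq_int0 => u _; apply: IHs => k.
  by move=> ks; apply: sP; rewrite inE ks orbT.
by move=> Pk; rewrite !set_coordE yz.
Qed.

Lemma ucube_continuous F G : ucube G -> (forall x, cube x -> F x = G x) ->
  {within cube, continuous F}.
Proof.
move=> [_ uG] FG; apply/subspace_continuousP => x xc.
apply/cvgrPdist_le => e e0; have [d d0 Hd] := uG e e0.
apply/nbhs_ballP; exists d => //= y xy yc.
suff H : `|F x - F y| <= e by exact: H.
by rewrite (FG x xc) (FG y yc); apply: Hd => // k; case: xy => _; exact.
Qed.

End partial_integrals.

(** * Interpolation and increments along coordinates *)

Section coordinate_combinations.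
Context {R : realType} {n : nat}.
Implicit Types (x y z : 'rV[R]_n) (i k : 'I_n) (f g F G : 'rV[R]_n -> R).
Implicit Types (u v : R) (s t : seq 'I_n).
Local Notation cube := (@unit_cube R n).

(** The common form of interpolation between two knots (weights affine in [y 0 i]) and of the
    increment between them (weights 1 and -1), so that commutation rules are proved once. *)
Definition comb (w : 'I_n -> bool -> R -> R) (a : 'I_n -> bool -> R) i F y :=
  w i false (y 0 i) * F (set_coord y i (a i false)) +
  w i true (y 0 i) * F (set_coord y i (a i true)).

Lemma combC w w' a i k F : i != k ->
  comb w a i (comb w' a k F) = comb w' a k (comb w a i F).
Proof.
move=> ik; have ki : k != i by rewrite eq_sym.
apply/funext => y; rewrite /comb !set_coord_neq //.
by rewrite !(set_coordC _ _ _ ik); ring.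
Qed.

Lemma foldr_combC w w' a i s F : i \notin s ->
  comb w a i (foldr (comb w' a) F s) = foldr (comb w' a) (comb w a i F) s.
Proof.
elim: s => //= k s IHs; rewrite inE negb_or => /andP[ik /IHs <-].
exact: combC.
Qed.

Definition at_nodes (a : 'I_n -> bool -> R) (P : pred 'I_n) z :=
  forall i, P i -> exists b, z 0 i = a i b.

Lemma at_nodes_set_coord a P z i b : at_nodes a P z ->
  at_nodes a (predU1 i P) (set_coord z i (a i b)).
Proof.
move=> zP k; have [->|ki] := eqVneq k i; first by exists b; rewrite set_coord_eq.
by rewrite set_coord_neq //= (negbTE ki) => /zP.
Qed.

(** Each combination puts a node into its coordinate before evaluating, so the values of [F] away
    from the nodes never enter. *)
Lemma eq_combs w a s (P : pred 'I_n) F G y :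
  (forall z, at_nodes a [pred i | P i || (i \in s)] z -> F z = G z) ->
  at_nodes a P y -> foldr (comb w a) F s y = foldr (comb w a) G s y.
Proof.
elim: s P y => [|i s IHs] P y FG yP /=.
  by apply: FG => i /=; rewrite orbF; exact: yP.
have H b : foldr (comb w a) F s (set_coord y i (a i b)) =
           foldr (comb w a) G s (set_coord y i (a i b)).
  apply: (IHs (predU1 i P)); last exact: at_nodes_set_coord.
  move=> z zP; apply: FG => k /= Hk; apply: zP.
  by move: Hk; rewrite /= inE orbCA orbA.
by rewrite /comb !H.
Qed.

(** The weights depend on the coordinate [k] only and act as constants for the derivative in [i]. *)
Lemma pderiv_comb w a i k F F' x : k != i -> cube x ->
  (forall b, 0 <= a k b <= 1) ->
  (forall y, cube y -> pderiv cube i F y (F' y)) ->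
  pderiv cube i (comb w a k F) x (comb w a k F' x).
Proof.
move=> ki xc a01 H e e0; have ik : i != k by rewrite eq_sym.
(* Each of the two derivatives is used with tolerance [e / W]; the summand 1 keeps [W] positive when
   both weights vanish. *)
pose W := `|w k false (x 0 k)| + `|w k true (x 0 k)| + 1.
have W0 : 0 < W.
  by have := normr_ge0 (w k false (x 0 k)); have := normr_ge0 (w k true (x 0 k)); rewrite /W; lra.
have [r r0 Hr] := H _ (set_coord_cube k xc (a01 false)) _ (divr_gt0 e0 W0).
have [s s0 Hs] := H _ (set_coord_cube k xc (a01 true)) _ (divr_gt0 e0 W0).
exists (Num.min r s) => [|v vc]; first by rewrite lt_min r0 s0.
have v01 : 0 <= v <= 1 by have := vc i; rewrite set_coord_eq.
rewrite lt_min => /andP[vr vs].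
have := Hr v; rewrite set_coord_neq // => /(_ _ vr) {}Hr.
have := Hs v; rewrite set_coord_neq // => /(_ _ vs) {}Hs.
have {}Hr := Hr (set_coord_cube i (set_coord_cube k xc (a01 false)) v01).
have {}Hs := Hs (set_coord_cube i (set_coord_cube k xc (a01 true)) v01).
rewrite /comb set_coord_neq // !(set_coordC _ _ _ ik).
set w0 := w k false _ in W W0 Hr Hs *; set w1 := w k true _ in W W0 Hr Hs *.
set p0 := F (set_coord (set_coord x k (a k false)) i v) in Hr *.
set q0 := F (set_coord x k (a k false)) in Hr *.
set l0 := F' (set_coord x k (a k false)) in Hr *.
set p1 := F (set_coord (set_coord x k (a k true)) i v) in Hs *.
set q1 := F (set_coord x k (a k true)) in Hs *.
set l1 := F' (set_coord x k (a k true)) in Hs *.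
have -> : w0 * p0 + w1 * p1 - (w0 * q0 + w1 * q1) - (w0 * l0 + w1 * l1) * (v - x 0 i) =
  w0 * (p0 - q0 - l0 * (v - x 0 i)) + w1 * (p1 - q1 - l1 * (v - x 0 i)) by ring.
apply: le_trans (ler_normD _ _) _; rewrite !normrM.
apply: (@le_trans _ _ ((`|w0| + `|w1|) * (e / W * `|v - x 0 i|))).
  by rewrite mulrDl; apply: lerD; apply: ler_wpM2l.
rewrite mulrA; apply: ler_wpM2r => //.
have -> : (`|w0| + `|w1|) * (e / W) = e * ((`|w0| + `|w1|) / W) by ring.
rewrite ler_piMr ?(ltW e0) // ler_pdivrMr // mul1r /W; lra.
Qed.

Lemma partials_comb w a k s F : k \notin s -> (forall b, 0 <= a k b <= 1) ->
  has_partials cube s F ->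
  has_partials cube s (comb w a k F) /\
  forall x, cube x ->
    partials cube s (comb w a k F) x = comb w a k (partials cube s F) x.
Proof.
move=> + a01; elim: s => [//|i s IHs] /=; rewrite inE negb_or => /andP[ki ks] [hs hi].
have [h1 e1] := IHs ks hs.
have pd x : cube x -> pderiv cube i (partials cube s (comb w a k F)) x
    (comb w a k (partial cube i (partials cube s F)) x).
  move=> xc; apply: (@eq_pderiv_cube _ _ _ (comb w a k (partials cube s F))) => //.
    by move=> y yc; rewrite e1.
  by apply: pderiv_comb => // y yc; exact: has_partial_pderiv.
split; first by split=> //; exact: pderiv_has_partial pd.
by move=> x xc; apply: pderiv_partial_cube => //; exact: pd.
Qed.

Lemma partials_combs w a t s F : (forall k, k \in t -> k \notin s) ->
  (forall k b, 0 <= a k b <= 1) -> has_partials cube s F ->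
  has_partials cube s (foldr (comb w a) F t) /\
  forall x, cube x -> partials cube s (foldr (comb w a) F t) x =
                      foldr (comb w a) (partials cube s F) t x.
Proof.
move=> ts a01 hF; elim: t ts => [//|k t IHt] ts /=.
have [|h1 e1] := IHt; first by move=> l lt; apply: ts; rewrite inE lt orbT.
have [h2 e2] := partials_comb w (ts k (mem_head _ _)) (a01 k) h1.
split=> // x xc; rewrite e2 // /comb !e1 //; exact: set_coord_cube.
Qed.

Definition increment (a : 'I_n -> bool -> R) :=
  comb (fun _ b _ => if b then 1 else - 1) a.

Lemma incrementE a i F y :
  increment a i F y = F (set_coord y i (a i true)) - F (set_coord y i (a i false)).
Proof. by rewrite /increment /comb mul1r mulN1r addrC. Qed.

Definition dist_coord y x : 'rV[R]_n := \row_k `|y 0 k - x 0 k|.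

Lemma dist_coord_set_coord y x i u :
  dist_coord (set_coord y i u) x = set_coord (dist_coord y x) i `|u - x 0 i|.
Proof. by apply/rowP => k; rewrite !mxE; case: eqP => [->|]. Qed.

Lemma dist_coord_cube y x : cube y -> cube x -> cube (dist_coord y x).
Proof.
move=> yc xc k; rewrite mxE normr_ge0 /= ler_norml.
by have := yc k; have := xc k; lra.
Qed.

Definition coord_nondecreasing G := forall y z, cube y -> cube z ->
  (forall k, y 0 k <= z 0 k) -> G y <= G z.

(** The mixed increment integrates the mixed derivative, one variable at a time. If the derivative
    differs from [c] by at most [G] of the coordinatewise distances to [x], then in each variable
    the increment differs from [c] times the side by at most the integral of [G] over the distances
    from 0 to the side. Monotonicity of [G] makes an end of the interval the worst position of
    [x]. *)
Lemma increments_bound a (b : 'I_n -> R) s F G c x : uniq s ->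
  (forall k e, 0 <= a k e <= 1) -> (forall k, a k true - a k false = b k) ->
  (forall k, a k false <= x 0 k <= a k true) -> cube x ->
  has_partials cube s F -> ucube G -> coord_nondecreasing G ->
  (forall y, cube y -> (forall k, k \in s -> a k false <= y 0 k <= a k true) ->
     (forall k, k \notin s -> y 0 k = x 0 k) ->
     `|partials cube s F y - c| <= G (dist_coord y x)) ->
  `|foldr (increment a) F s x - c * \prod_(k <- s) b k|
     <= pints s G (set_coords s b 0).
Proof.
move=> us a01 ab ax xc.
elim: s F G c us => [|i s IHs] F G c /= us.
  move=> _ _ _ H; have := H x xc; rewrite big_nil mulr1 set_coords_nil => H'.
  have -> : 0 = dist_coord x x by apply/rowP => k; rewrite !mxE subrr normr0.
  exact: H'.
have /andP[si us'] := us; move=> [hs hi] uG mG H.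
have b01 k : 0 <= b k <= 1 by have := a01 k true; have := a01 k false; have := ax k; rewrite -ab; lra.
(* The bound for the remaining variables: [G] integrated over the whole side in the variable [i]. *)
pose G1 z := pint i G (set_coord z i (b i)).
have uI := ucube_pint i uG.
have uG1 : ucube G1.
  have [[C HC] Hu] := uI; split.
    by exists C => z zc; apply/HC/set_coord_cube.
  move=> e e0; have [d d0 Hd] := Hu e e0; exists d => // y z yc zc yz.
  apply: Hd; [exact: set_coord_cube|exact: set_coord_cube|] => k.
  by rewrite !set_coordE; case: eqP => // _; rewrite subrr normr0.
have mG1 : coord_nondecreasing G1.
  move=> y z yc zc yz; rewrite /G1 !pint_set_coord.
  apply: le_int0 => //; [exact: ucube_section|exact: ucube_section|] => u ub.
  have u01 : 0 <= u <= 1 by have := b01 i; lra.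
  apply: mG; [exact: set_coord_cube|exact: set_coord_cube|] => k.
  by rewrite !set_coordE; case: eqP.
have [h1 e1] := partials_comb (fun _ e _ => if e then 1 else - 1) si (a01 i) hs.
have := IHs (increment a i F) G1 (c * b i) us' h1 uG1 mG1.
rewrite big_cons -mulrA [increment a i _ in X in X -> _]/increment -foldr_combC //.
move=> H1; apply: le_trans (H1 _) _ => [y yc yin yout|].
  rewrite e1 // -/(increment a i _ _) incrementE /G1 pint_set_coord -ab.
  set D := dist_coord y x; have Dc : cube D by exact: dist_coord_cube.
  have a0 := a01 i false; have a1 := a01 i true; have axi := ax i.
  (* The other coordinates of [y] are frozen, leaving a one-variable function whose derivative is
     controlled by the distance to [x 0 i]. *)
  apply: (@growth_norm_le _ (a i false) (a i true) (x 0 i) c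
    (fun u => G (set_coord D i u)) (int0 (fun u => G (set_coord D i u)))
    (fun v => partials cube s F (set_coord y i v))
    (fun v => partial cube i (partials cube s F) (set_coord y i v))).
  - have := @pderiv_section _ _ i (pint i G) G D Dc (fun z => pderiv_pint i uG).
    by congr deriv_on; apply/funext => v; rewrite pint_set_coord.
  - by rewrite int0_0.
  - move=> u v uv v1; apply: mG; [apply: set_coord_cube|apply: set_coord_cube|] => //; try lra.
    by move=> k; rewrite !set_coordE; case: eqP => // _; lra.
  - lra.
  - lra.
  - apply: deriv_on_sub (section_deriv_cube yc hi); lra.
  - move=> u uab; rewrite /D -dist_coord_set_coord; apply: H.
    + by apply: set_coord_cube => //; lra.
    + move=> k; rewrite set_coordE inE; case: eqP => [->//|_ /=]; exact: yin.
    + move=> k; rewrite set_coordE inE negb_or => /andP[/negbTE ->]; exact: yout.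
rewrite /G1 pints_set_coord // -set_coords_cons.
(* The induction has produced the integral in [i] as the innermost one; a permutation makes it the
   outermost. *)
have -> : pints s (pint i G) = pints (rcons s i) G by rewrite /pints foldr_rcons.
rewrite (@perm_pints _ _ _ (i :: s)) // ?perm_rcons //.
apply: set_coords_cube => // k; rewrite mxE; lra.
Qed.

End coordinate_combinations.

(** * The multilinear spline *)

Section spline.
Context {R : realType} {n : nat}.
Variables (m j : 'I_n -> nat).
Hypothesis m_gt0 : forall i, (0 < m i)%N.
Implicit Types (x y z : 'rV[R]_n) (i k : 'I_n) (f g F G : 'rV[R]_n -> R).
Implicit Types (u v : R) (s : seq 'I_n).

Definition knot i (b : bool) : R := (j i + b)%:R / (m i)%:R.

Definition interp := @comb R n (fun i => spline_basis (m i) (j i)) knot.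

Let mR_neq0 i : (m i)%:R != 0 :> R.
Proof. by rewrite pnatr_eq0 -lt0n. Qed.

Lemma spline_basis_knot i (b c : bool) :
  spline_basis (m i) (j i) b (knot i c) = (b == c)%:R :> R.
Proof.
rewrite /spline_basis /knot mulrBr !mulrA !(mulrC (m i)%:R) !mulfK //.
by case: b c => -[]; rewrite ?addn1 ?addn0 -?natr1 /=; ring.
Qed.

Lemma spline_basisE i (b : bool) u : spline_basis (m i) (j i) b u =
  spline_basis (m i) (j i) false u * (b == false)%:R +
  spline_basis (m i) (j i) true u * (b == true)%:R :> R.
Proof. by case: b; rewrite /= ?mulr0 ?mulr1 ?addr0 ?add0r. Qed.

(** At a vertex of the block the basis products are 1 for that vertex and 0 for every other. *)
Lemma spline_piece_knot f z : at_nodes knot predT z -> spline_piece m f j z = f z.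
Proof.
move=> zn; have /(_ _)/cid-/all_sig[b Hb] : forall i, exists b, z 0 i = knot i b.
  by move=> i; apply: zn.
have zE : node m (fun i => j i + [ffun i => b i] i)%N = z.
  by apply/rowP => i; rewrite mxE ffunE Hb.
have w1 : \prod_(i < n) spline_basis (m i) (j i) ([ffun i => b i] i) (z 0 i) = 1.
  by apply: big1 => i _; rewrite ffunE Hb spline_basis_knot eqxx.
rewrite /spline_piece (bigD1 [ffun i => b i]) //= zE w1 mulr1 big1 ?addr0 // => l lb.
have [i li] : exists i, l i != b i.
  apply/existsP; rewrite -negb_forall; apply: contra lb => /forallP H.
  by apply/eqP/ffunP => i; rewrite ffunE; apply/eqP/H.
by rewrite (bigD1 i) //= Hb spline_basis_knot (negbTE li) mul0r mulr0.
Qed.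

(** The piece is affine in each variable, and interpolation at two points reproduces affine
    functions. *)
Lemma interp_spline_piece f i : interp i (spline_piece m f j) = spline_piece m f j.
Proof.
apply/funext => y; rewrite /interp /comb /spline_piece !mulr_sumr -big_split.
apply: eq_bigr => l _ /=; rewrite (bigD1 i) // [in X in _ + X](bigD1 i) //=.
rewrite [in RHS](bigD1 i) //= !set_coord_eq !spline_basis_knot [in RHS]spline_basisE.
have H b : \prod_(k < n | k != i) spline_basis (m k) (j k) (l k) (set_coord y i (knot i b) 0 k) =
    \prod_(k < n | k != i) spline_basis (m k) (j k) (l k) (y 0 k).
  by apply: eq_bigr => k ki; rewrite set_coord_neq.
by rewrite !H; set Q := \prod_(k < n | _) _; rewrite /spline_basis; ring.
Qed.

(** Being fixed by [interp i] means being affine in the [i]-th variable, so the increment over a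
    step of length [1 / m i] gives the slope and the remainder is exactly 0. *)
Lemma partial_setT_interp i F : interp i F = F ->
  partial setT i F = fun y => (m i)%:R * increment knot i F y.
Proof.
move=> FE; apply/funext => y; apply: pderiv_partial; first exact: setT_accumulation.
move=> e e0; exists 1 => // v _ _.
have -> : F (set_coord y i v) - F y - (m i)%:R * increment knot i F y * (v - y 0 i) = 0.
  rewrite -[in X in X - _ - _]FE -[in X in _ - X - _]FE incrementE /interp /comb.
  by rewrite set_coord_eq !set_coordK /spline_basis; ring.
by rewrite normr0 mulr_ge0 // ltW.
Qed.

Lemma interp_increments i s F c : i \notin s -> interp i F = F ->
  interp i (fun y => c * foldr (increment knot) F s y) =
  (fun y => c * foldr (increment knot) F s y).
Proof.
move=> si FE; rewrite -[in RHS]FE -[in RHS]foldr_combC //.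
by apply/funext => y; rewrite /interp /comb; ring.
Qed.

Lemma partials_setT_interp s F : uniq s -> (forall i, interp i F = F) ->
  partials setT s F =
  fun y => (\prod_(i <- s) (m i)%:R) * foldr (increment knot) F s y.
Proof.
move=> + FE; elim: s => [_|i s IHs /= /andP[si us]].
  by apply/funext => y; rewrite big_nil mul1r.
rewrite -/(partials _ _ _) IHs // partial_setT_interp; last exact: interp_increments.
by apply/funext => y; rewrite big_cons /increment /comb; ring.
Qed.

Lemma mderiv_spline_piece (r : {ffun 'I_n -> bool}) f x :
  mderiv setT r (spline_piece m f j) x = (\prod_(i in supp r) (m i)%:R) *
    foldr (increment knot) (foldr interp f (enum (~: supp r))) (enum (supp r)) x.
Proof.
rewrite /mderiv partials_setT_interp ?enum_uniq //; last first.
  by move=> i; exact: interp_spline_piece.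
rewrite big_enum /=; congr (_ * _).
have PE s : spline_piece m f j = foldr interp (spline_piece m f j) s.
  by elim: s => //= i s <-; rewrite interp_spline_piece.
(* Interpolation outside the support is inserted first. Every coordinate is then set to a knot
   before evaluation, and at the vertices the piece may be replaced by [f]. *)
rewrite [spline_piece m f j](PE (enum (~: supp r))).
apply: (@eq_combs _ _ _ _ _ pred0) => // y yM.
apply: (@eq_combs _ _ _ _ _ [pred i | i \in supp r]) => [z zn|i /= iM].
  apply: spline_piece_knot => i _; apply: zn.
  by rewrite /= mem_enum finset.in_setC orbN.
by apply: yM; rewrite /= mem_enum.
Qed.

End spline.

(** * Concave moduli of continuity and p-norms *)

Section concave_modulus.
Context {R : realType} {n : nat}.
Variables (p : R) (Omega : R -> R).
Hypotheses (p_itv : 1 <= p <= 3) (Omega_MC : MC_type Omega)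
  (Omega_concave : concave_function `[0, +oo[ Omega).
Implicit Types (x y z : 'rV[R]_n) (i k : 'I_n) (a b c s t : R).
Local Notation cube := (@unit_cube R n).

Let p1 : 1 <= p. Proof. by case/andP: p_itv. Qed.

Let p3 : p <= 3. Proof. by case/andP: p_itv. Qed.

Let p_gt0 : 0 < p. Proof. by apply: lt_le_trans p1. Qed.

Let pV_gt0 : 0 < p^-1. Proof. by rewrite invr_gt0. Qed.

Lemma powR_convex q a b s : 1 <= q -> 0 <= a -> 0 <= b -> 0 <= s <= 1 ->
  ((1 - s) * a + s * b) `^ q <= (1 - s) * a `^ q + s * b `^ q.
Proof.
move=> q1 a0 b0 /andP[s0 s1].
have := @convex_powR R q q1 (Itv01 s0 s1) b a.
rewrite !inE /= !in_itv /= !andbT => /(_ b0 a0).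
rewrite [X in X `^ _]convRE [X in _ <= X]convRE /= /unstable.onem.
by rewrite [s * b + _]addrC [s * _ + _]addrC.
Qed.

Lemma Omega_concaveE a b s : 0 <= a -> 0 <= b -> 0 <= s <= 1 ->
  (1 - s) * Omega a + s * Omega b <= Omega ((1 - s) * a + s * b).
Proof.
move=> a0 b0 /andP[s0 s1].
have := @Omega_concave (Itv01 s0 s1) b a.
rewrite !inE /= !in_itv /= !andbT => /(_ b0 a0).
rewrite [X in Omega X]convRE [X in _ <= X]convRE /= /unstable.onem.
rewrite [s * b + _]addrC; lra.
Qed.

Lemma Omega_le a b : 0 <= a -> a <= b -> Omega a <= Omega b.
Proof.
move=> a0 ab; apply: (MC_nondecreasing Omega_MC) => //; rewrite in_itv/= andbT //.
exact: le_trans ab.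
Qed.

Lemma Omega_ge0 a : 0 <= a -> 0 <= Omega a.
Proof. by move=> a0; rewrite -(MC_0 Omega_MC); exact: Omega_le. Qed.

(** By subadditivity and monotonicity [Omega] is a modulus of continuity for itself. *)
Lemma Omega_dist a b c : 0 <= a -> 0 <= b -> `|a - b| <= c ->
  `|Omega a - Omega b| <= Omega c.
Proof.
wlog ab : a b / b <= a => [H a0 b0 abc|a0 b0 abc].
  case/orP: (le_total b a) => ab; first exact: H.
  by rewrite distrC; apply: H => //; rewrite distrC.
have {}abc : a - b <= c by rewrite ger0_norm ?subr_ge0 // in abc.
have d0 : 0 <= a - b by lra.
rewrite ger0_norm ?subr_ge0 ?Omega_le //.
have /(_ b (a - b)) := MC_subadditive Omega_MC.
rewrite !in_itv /= !andbT b0 d0 subrKC => /(_ isT isT).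
have := Omega_le d0 abc; lra.
Qed.

Lemma Omega_small : forall e, 0 < e ->
  exists2 d, 0 < d & forall t, 0 <= t <= d -> Omega t <= e.
Proof.
move=> e e0; have /subspace_continuousP/(_ (0 : R)) := MC_continuous Omega_MC.
rewrite /= in_itv /= lexx => /(_ isT)/cvgrPdist_le/(_ e e0)[d /= d0 Hd].
exists (d / 2) => [|t /andP[t0 td]]; first lra.
have O0 := MC_0 Omega_MC; have Ot := Omega_ge0 t0.
have H : `|Omega 0 - Omega t| <= e.
  apply: Hd; last by rewrite /= in_itv /= t0.
  by rewrite /= sub0r normrN ger0_norm //; lra.
by move: H; rewrite O0 sub0r normrN ger0_norm.
Qed.

Lemma pnorm_ge0 x : 0 <= pnorm p x.
Proof. exact: powR_ge0. Qed.

Lemma le_powR q a b : 0 <= q -> 0 <= a -> a <= b -> a `^ q <= b `^ q.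
Proof.
by move=> q0 a0 ab; apply: ge0_ler_powR => //; rewrite nnegrE //; exact: le_trans ab.
Qed.

Lemma le_pnorm x y : (forall k, `|x 0 k| <= `|y 0 k|) -> pnorm p x <= pnorm p y.
Proof.
move=> xy; apply: le_powR; rewrite ?(ltW pV_gt0) //.
  by apply: sumr_ge0 => k _; exact: powR_ge0.
by apply: ler_sum => k _; apply: le_powR; rewrite ?(ltW p_gt0).
Qed.

Lemma pnorm_powR x : pnorm p x `^ p = \sum_i `|x 0 i| `^ p.
Proof.
rewrite /pnorm -powRrM mulVf ?gt_eqF // powRr1 //.
by apply: sumr_ge0 => k _; exact: powR_ge0.
Qed.

Lemma pnorm_eq0 x : pnorm p x = 0 -> x = 0.
Proof.
move=> x0; apply/rowP => k; rewrite mxE; have := pnorm_powR x.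
rewrite x0 powR0 ?gt_eqF // => /esym/eqP.
rewrite psumr_eq0 => [|i _]; last exact: powR_ge0.
by move=> /allP/(_ k); rewrite mem_index_enum => /(_ isT)/= /eqP/powR_eq0_eq0/normr0P/eqP.
Qed.

(** Minkowski's inequality: after division by [a + b], the sum is a convex combination of the
    normalised vectors, with weights proportional to their norms [a] and [b], and the [p]-th power
    is convex. *)
Lemma ler_pnormD x y : pnorm p (x + y) <= pnorm p x + pnorm p y.
Proof.
have [x0|x0] := eqVneq (pnorm p x) 0.
  by rewrite x0 (pnorm_eq0 x0) !add0r.
have [y0|y0] := eqVneq (pnorm p y) 0.
  by rewrite y0 (pnorm_eq0 y0) !addr0.
have {}x0 : 0 < pnorm p x by rewrite lt_neqAle eq_sym x0 pnorm_ge0.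
have {}y0 : 0 < pnorm p y by rewrite lt_neqAle eq_sym y0 pnorm_ge0.
move aE: (pnorm p x) x0 => a x0; move bE: (pnorm p y) y0 => b y0.
have ab : 0 < a + b by exact: addr_gt0.
have s01 : 0 <= b / (a + b) <= 1.
  apply/andP; split; first exact: divr_ge0 (ltW y0) (ltW ab).
  by rewrite ler_pdivrMr // mul1r lerDr ltW.
have sE : 1 - b / (a + b) = a / (a + b) by field; rewrite gt_eqF.
have : pnorm p (x + y) `^ p <= (a + b) `^ p.
  rewrite pnorm_powR.
  apply: (@le_trans _ _ (\sum_k ((a + b) `^ p *
    ((1 - b / (a + b)) * (`|x 0 k| / a) `^ p + b / (a + b) * (`|y 0 k| / b) `^ p)))).
    apply: ler_sum => k _.
    have ak : 0 <= `|x 0 k| / a by exact: divr_ge0 (normr_ge0 _) (ltW x0).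
    have bk : 0 <= `|y 0 k| / b by exact: divr_ge0 (normr_ge0 _) (ltW y0).
    have := ler_wpM2l (powR_ge0 (a + b) p) (powR_convex p1 ak bk s01).
    apply: le_trans.
    rewrite -powRM ?(ltW ab) //; last first.
      by case/andP: s01 => s0 s1; apply: addr_ge0; apply: mulr_ge0 => //; rewrite subr_ge0.
    apply: le_powR; rewrite ?(ltW p_gt0) // mxE sE.
    apply: le_trans (ler_normD _ _) _; rewrite le_eqVlt; apply/orP; left; apply/eqP.
    by field; rewrite !gt_eqF.
  rewrite -mulr_sumr big_split /= -!mulr_sumr.
  have U z c : 0 < c -> c = pnorm p z -> \sum_k (`|z 0 k| / c) `^ p = 1.
    move=> c0 cz; have : \sum_k (`|z 0 k| / c) `^ p * c `^ p = c `^ p.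
      rewrite {3}cz pnorm_powR; apply: eq_bigr => k _.
      by rewrite -powRM ?divr_ge0 ?(ltW c0) // divfK ?gt_eqF.
    by rewrite -mulr_suml -[RHS]mul1r => /mulIf; apply; rewrite gt_eqF ?powR_gt0.
  by rewrite (U x a) // (U y b) // !mulr1 subrK mulr1.
move=> H; rewrite leNgt; apply/negP => lt.
have := @gt0_ltr_powR R p p_gt0 (a + b) (pnorm p (x + y)).
by rewrite !nnegrE pnorm_ge0 (ltW ab) => /(_ isT isT lt); rewrite ltNge H.
Qed.

Lemma pnormN x : pnorm p (- x) = pnorm p x.
Proof. by rewrite /pnorm; congr (_ `^ _); apply: eq_bigr => k _; rewrite mxE normrN. Qed.

Lemma Omega_pnorm_dist x y :
  `|Omega (pnorm p x) - Omega (pnorm p y)| <= Omega (pnorm p (x - y)).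
Proof.
apply: Omega_dist; rewrite ?pnorm_ge0 // ler_norml.
have H1 := ler_pnormD (x - y) y; have H2 := ler_pnormD (y - x) x.
rewrite subrK in H1; rewrite subrK -opprB pnormN in H2.
by rewrite lerBlDr H1 andbT lerNl opprB lerBlDr.
Qed.

Lemma pnorm_le_cst x d : 0 <= d -> (forall k, `|x 0 k| <= d) ->
  pnorm p x <= n%:R `^ p^-1 * d.
Proof.
move=> d0 xd; have <- : (n%:R * d `^ p) `^ p^-1 = n%:R `^ p^-1 * d.
  by rewrite powRM ?powR_ge0 // -powRrM mulfV ?gt_eqF // powRr1.
apply: le_powR; rewrite ?(ltW pV_gt0) //.
  by apply: sumr_ge0 => k _; exact: powR_ge0.
apply: (@le_trans _ _ (\sum_(k < n) d `^ p)).
  by apply: ler_sum => k _; apply: le_powR; rewrite ?(ltW p_gt0).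
by rewrite sumr_const card_ord mulr_natl.
Qed.

(** The coordinatewise 1-Lipschitz map [v] covers both uses: translation by the extremal point, and
    freezing some coordinates at half a step. *)
Lemma ucube_Omega_pnorm (v : 'rV[R]_n -> 'rV[R]_n) :
  (forall x y k, `|v x 0 k - v y 0 k| <= `|x 0 k - y 0 k|) ->
  ucube (fun x => Omega (pnorm p (v x))).
Proof.
move=> vL; split.
  exists (Omega (pnorm p (v 0)) + Omega (n%:R `^ p^-1)) => x xc.
  have H2 := Omega_pnorm_dist (v x) (v 0).
  have : pnorm p (v x - v 0) <= n%:R `^ p^-1 * 1.
    apply: pnorm_le_cst => // k; rewrite !mxE; apply: le_trans (vL _ _ _) _.
    by rewrite mxE subr0 ger0_norm; case/andP: (xc k).
  rewrite mulr1 => /(Omega_le (pnorm_ge0 _)) H1.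
  rewrite ger0_norm ?Omega_ge0 ?pnorm_ge0 // addrC -lerBlDr.
  exact: le_trans (ler_norm _) (le_trans H2 H1).
move=> e e0; have [d d0 Hd] := Omega_small e0.
have N0 : 0 < n%:R `^ p^-1 + 1 :> R by rewrite ltr_wpDl // powR_ge0.
have dN : 0 < d / (n%:R `^ p^-1 + 1) by exact: divr_gt0.
exists (d / (n%:R `^ p^-1 + 1)) => // x y _ _ xy.
apply: le_trans (Omega_pnorm_dist _ _) _; apply: Hd; rewrite pnorm_ge0 /=.
apply: (le_trans (@pnorm_le_cst _ _ (ltW dN) _)) => [k|].
  by rewrite !mxE (le_trans (vL _ _ _)) // ltW.
by rewrite mulrCA ler_piMr ?(ltW d0) // ler_pdivrMr // mul1r lerDl ler01.
Qed.

(* Lyapunov's inequality reduces the bound to the exponent 3, where it reads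
   s (1 - s) (1 - 2 s (1 - s)) <= 1 / 8. *)
Lemma two_point_moment s : 0 <= s <= 1 ->
  (1 - s) * s `^ p + s * (1 - s) `^ p <= 2^-1 `^ p.
Proof.
move=> s01; have s0 : 0 <= s by lra. have s1 : 0 <= 1 - s by lra.
have X0 : 0 <= (1 - s) * s `^ p + s * (1 - s) `^ p.
  by rewrite addr_ge0 // mulr_ge0 // powR_ge0.
have q1 : 1 <= 3 / p by rewrite ler_pdivlMr // mul1r.
have q0 : 0 <= p / 3 by rewrite divr_ge0 // ltW.
have pq : 3 / p * (p / 3) = 1 by field; rewrite gt_eqF.
have pq' : p * (3 / p) = 3 by field; rewrite gt_eqF.
have pow3 a : 0 <= a -> (a `^ p) `^ (3 / p) = a ^+ 3.
  by move=> a0; rewrite -powRrM pq' powR_mulrn.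
have -> : (1 - s) * s `^ p + s * (1 - s) `^ p =
    (((1 - s) * s `^ p + s * (1 - s) `^ p) `^ (3 / p)) `^ (p / 3).
  by rewrite -[RHS]powRrM pq powRr1.
have -> : 2^-1 `^ p = (2^-1 ^+ 3) `^ (p / 3) :> R.
  by rewrite -powR_mulrn ?invr_ge0 // -powRrM; congr (_ `^ _); field.
apply: le_powR => //; first exact: powR_ge0.
apply: le_trans (powR_convex q1 (powR_ge0 _ _) (powR_ge0 _ _) s01) _.
rewrite !pow3 //; have : 0 <= (s - 2^-1) ^+ 2 by exact: sqr_ge0.
nra.
Qed.

Lemma Omega_two_point (mi s c : R) : 0 <= s <= 1 -> 0 < mi -> 0 <= c ->
  (1 - s) * Omega ((c + (s / mi) `^ p) `^ p^-1) +
  s * Omega ((c + ((1 - s) / mi) `^ p) `^ p^-1) <=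
  Omega ((c + (1 / (2 * mi)) `^ p) `^ p^-1).
Proof.
move=> s01 m0 c0; have s0 : 0 <= s by lra. have s1 : 0 <= 1 - s by lra.
have mV0 : 0 <= mi^-1 by rewrite invr_ge0 ltW.
apply: le_trans (Omega_concaveE (powR_ge0 _ _) (powR_ge0 _ _) s01) _.
apply: Omega_le; first by rewrite addr_ge0 // mulr_ge0 // powR_ge0.
set A := c + _ `^ p; set B := c + _ `^ p; set C := c + _ `^ p.
have A0 : 0 <= A by rewrite addr_ge0 // powR_ge0.
have B0 : 0 <= B by rewrite addr_ge0 // powR_ge0.
(* Convexity of the [p]-th power at the [p]-th roots of [A] and [B] amounts to concavity of the
   [p]-th root. *)
have H := powR_convex p1 (powR_ge0 A p^-1) (powR_ge0 B p^-1) s01.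
have pK a : 0 <= a -> (a `^ p^-1) `^ p = a.
  by move=> a0; rewrite -powRrM mulVf ?gt_eqF // powRr1.
rewrite [X in _ <= _ * X + _](pK A A0) [X in _ <= _ + _ * X](pK B B0) in H.
have L0 : 0 <= (1 - s) * A `^ p^-1 + s * B `^ p^-1.
  by rewrite addr_ge0 // mulr_ge0 // powR_ge0.
have -> : (1 - s) * A `^ p^-1 + s * B `^ p^-1 =
    (((1 - s) * A `^ p^-1 + s * B `^ p^-1) `^ p) `^ p^-1.
  by rewrite -powRrM mulfV ?gt_eqF // powRr1.
apply: le_powR; rewrite ?(ltW pV_gt0) ?powR_ge0 //; apply: le_trans H _.
rewrite /A /B /C div1r invfM !powRM ?invr_ge0 ?(ltW m0) ?ler0n //.
have := ler_wpM2r (powR_ge0 mi^-1 p) (two_point_moment s01).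
set u := s `^ p; set v := (1 - s) `^ p; set w := mi^-1 `^ p; set h := 2^-1 `^ p.
have -> : (1 - s) * (c + u * w) + s * (c + v * w) =
  c + ((1 - s) * u + s * v) * w by ring.
by rewrite lerD2l.
Qed.

End concave_modulus.

(** * The worst-case error *)

Section extremal.
Context {R : realType} {n : nat}.
Variables (p : R) (Omega : R -> R).
Hypotheses (p_itv : 1 <= p <= 3) (Omega_MC : MC_type Omega)
  (Omega_concave : concave_function `[0, +oo[ Omega).
Variables (m : 'I_n -> nat) (r : {ffun 'I_n -> bool}).
Hypothesis m_gt0 : forall i, (0 < m i)%N.
Implicit Types (x y z : 'rV[R]_n) (i k : 'I_n) (c : R) (j : 'I_n -> nat) (t : seq 'I_n).
Local Notation cube := (@unit_cube R n).
Local Notation M := (supp r).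

Let mR_gt0 i : 0 < (m i)%:R :> R. Proof. by rewrite ltr0n. Qed.

Definition half i : R := 1 / (2 * (m i)%:R).

Let half_gt0 i : 0 < half i. Proof. by rewrite divr_gt0 // mulr_gt0. Qed.

Definition side i : R := 1 / (m i)%:R.

Let side_itv i : 0 <= side i <= 1.
Proof.
by rewrite /side divr_ge0 ?ler01 ?ler0n //= ler_pdivrMr // mul1r ler1n.
Qed.

Lemma pnorm_bigD1 i x :
  pnorm p x = (\sum_(k < n | k != i) `|x 0 k| `^ p + `|x 0 i| `^ p) `^ p^-1.
Proof. by rewrite /pnorm (bigD1 i) //= addrC. Qed.

Lemma eq_pnorm x y : (forall k, `|x 0 k| = `|y 0 k|) -> pnorm p x = pnorm p y.
Proof. by move=> xy; rewrite /pnorm; under eq_bigr do rewrite xy. Qed.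

Definition half_off (P : pred 'I_n) y : 'rV[R]_n :=
  \row_k if P k then y 0 k else half k.

Lemma knot_itv j i (b : bool) : (j i < m i)%N -> 0 <= (knot m j i b : R) <= 1.
Proof.
move=> jm; rewrite /knot divr_ge0 //= ler_pdivrMr // mul1r ler_nat.
by case: b; rewrite ?addn1 ?addn0 // ltnW.
Qed.

Lemma knot_side j i : knot m j i true - knot m j i false = side i.
Proof. by rewrite /knot /side addn1 addn0 -natr1; field; rewrite gt_eqF. Qed.

(** In a coordinate of [t] the interpolant at [x] is a convex combination of values at the two
    neighbouring knots; [Omega_two_point] replaces both knot distances by half a step, one
    coordinate after another. *)
Lemma interps_bound j t (g : 'rV[R]_n -> R) c x y : uniq t ->
  (forall i, (j i < m i)%N) ->
  (forall i, knot m j i false <= x 0 i <= knot m j i true) ->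
  (forall z, cube z -> `|g z - c| <= Omega (pnorm p (z - x))) ->
  cube y -> (forall k, k \in t -> y 0 k = x 0 k) ->
  `|foldr (interp m j) g t y - c| <=
    Omega (pnorm p (half_off (fun k => k \notin t) (y - x))).
Proof.
move=> + jm jx gc; elim: t y => [|i t IHt] y /=.
  move=> _ yc _; have -> : half_off (fun k => k \notin [::]) (y - x) = y - x.
    by apply/rowP => k; rewrite mxE in_nil.
  exact: gc.
move=> /andP[it ut] yc yx.
have yi : y 0 i = x 0 i by apply: yx; rewrite mem_head.
have IH (b : bool) : `|foldr (interp m j) g t (set_coord y i (knot m j i b)) - c| <=
    Omega (pnorm p (half_off (fun k => k \notin t) (set_coord y i (knot m j i b) - x))).
  apply: IHt => //; first by apply: set_coord_cube => //; exact: knot_itv.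
  move=> k kt; rewrite set_coord_neq; last by apply: contraNneq it => <-.
  by apply: yx; rewrite inE kt orbT.
(* The relative position of [x 0 i] in its interval: the weights are [1 - s] and [s], the distances
   to the knots [s / m i] and [(1 - s) / m i]. *)
pose s := (m i)%:R * (x 0 i - knot m j i false).
have s1E : 1 - s = (m i)%:R * (knot m j i true - x 0 i).
  by rewrite /s /knot addn1 addn0 -natr1; field; rewrite gt_eqF.
have /andP[jx0 jx1] := jx i.
have s01 : 0 <= s <= 1.
  rewrite mulr_ge0 ?subr_ge0 ?(ltW (mR_gt0 i)) //= -subr_ge0 s1E.
  by rewrite mulr_ge0 ?subr_ge0 ?(ltW (mR_gt0 i)).
have w0 : spline_basis (m i) (j i) false (y 0 i) = 1 - s.
  by rewrite s1E yi /knot addn1.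
have w1 : spline_basis (m i) (j i) true (y 0 i) = s.
  have : spline_basis (m i) (j i) true (y 0 i) = 1 - spline_basis (m i) (j i) false (y 0 i) by [].
  by rewrite w0 opprB addrC subrK.
have sE : x 0 i - knot m j i false = s / (m i)%:R.
  by rewrite /s; field; rewrite gt_eqF.
have s1mE : knot m j i true - x 0 i = (1 - s) / (m i)%:R.
  by rewrite s1E; field; rewrite gt_eqF.
clearbody s; rewrite {1}/interp /comb -/(interp m j) w0 w1.
set A := foldr _ _ _ _ in IH *; set B := foldr _ _ _ _ in IH *.
have -> : (1 - s) * A + s * B - c = (1 - s) * (A - c) + s * (B - c) by ring.
have /andP[s0 s1] := s01; have s1' : 0 <= 1 - s by rewrite subr_ge0.
apply: le_trans (ler_normD _ _) _; rewrite !normrM (ger0_norm s0) (ger0_norm s1').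
have HA := IH false; have HB := IH true.
apply: le_trans (lerD (ler_wpM2l s1' HA) (ler_wpM2l s0 HB)) _.
rewrite !(pnorm_bigD1 i).
(* The contribution of the other coordinates is the same at both knots and in the target. *)
set C := \sum_(k < n | k != i) `|half_off _ (y - x) 0 k| `^ p.
have CE (b : bool) : \sum_(k < n | k != i) `|half_off (fun k => k \notin t)
    (set_coord y i (knot m j i b) - x) 0 k| `^ p = C.
  apply: eq_bigr => k ki; rewrite !mxE !inE (negbTE ki) /=; congr (`| _ | `^ p).
rewrite !CE.
have C0 : 0 <= C by apply: sumr_ge0 => k _; exact: powR_ge0.
have eF : `|half_off (fun k => k \notin t) (set_coord y i (knot m j i false) - x) 0 i| = s / (m i)%:R.
  by rewrite !mxE it eqxx distrC ger0_norm ?subr_ge0.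
have eT : `|half_off (fun k => k \notin t) (set_coord y i (knot m j i true) - x) 0 i| = (1 - s) / (m i)%:R.
  by rewrite !mxE it eqxx ger0_norm ?subr_ge0.
have eH : `|half_off (fun k => k \notin i :: t) (y - x) 0 i| = 1 / (2 * (m i)%:R).
  by rewrite mxE mem_head /= ger0_norm // ltW.
by rewrite eF eT eH; apply: Omega_two_point.
Qed.

Definition error_bound z := Omega (pnorm p (half_off (fun k => k \in M) z)).

Lemma ucube_error_bound : ucube error_bound.
Proof.
apply: ucube_Omega_pnorm => // x y k; rewrite !mxE; case: ifP => // _.
by rewrite subrr normr0.
Qed.

Lemma error_bound_nondecreasing : coord_nondecreasing error_bound.
Proof.
move=> y z yc zc yz; rewrite /error_bound.
apply: (Omega_le Omega_MC (pnorm_ge0 _ _)).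
apply: le_pnorm => [|k]; first exact: p_itv.
rewrite !mxE; case: ifP => // _.
have /andP[y0 _] := yc k; have /andP[z0 _] := zc k.
by rewrite !ger0_norm.
Qed.

(** The integral of the theorem, as an iterated primitive at the corner of the box with sides
    [1 / m i]. *)
Definition error_integral := pints (enum M) error_bound (set_coords (enum M) side 0).

Lemma prod_side : (\prod_(i in M) (m i)%:R) * \prod_(k <- enum M) side k = 1 :> R.
Proof.
rewrite big_enum /= -big_split /= big1 // => i _.
by rewrite /side; field; rewrite gt_eqF.
Qed.

Lemma prod_m_ge0 : 0 <= \prod_(i in M) (m i)%:R :> R.
Proof. by apply: prodr_ge0 => i _; exact: ler0n. Qed.

Lemma block_knot x i : cube x ->
  knot m (block m x) i false <= x 0 i <= knot m (block m x) i true.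
Proof.
move=> xc; have [lo hi] := half_open_block_block m_gt0 xc i.
rewrite /knot addn0 addn1 lo /=; move: hi.
by case: ifP => // _ /ltW.
Qed.

Lemma C_class_modulus_dist (f : 'rV[R]_n -> R) x z :
  C_class_modulus r p Omega f -> cube x -> cube z ->
  `|mderiv cube r f z - mderiv cube r f x| <= Omega (pnorm p (z - x)).
Proof.
move=> [_ fm] xc zc; have := fm (pnorm p (z - x)).
rewrite pnorm_ge0 /= => H; rewrite -lee_fin; apply: le_trans (H _).
  by apply: ereal_sup_ubound; exists z, x; split.
rewrite -[leRHS]mulr1; apply: pnorm_le_cst => // k.
rewrite !mxE ler_norml; have := xc k; have := zc k; lra.
Qed.

Lemma error_le (f : 'rV[R]_n -> R) x : C_class_modulus r p Omega f -> cube x ->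
  `|mderiv cube r f x - spline_deriv m r f x|
    <= \prod_(i in M) (m i)%:R * error_integral.
Proof.
move=> fC xc; have [fr _] := fC.
have [hf _] := fr r (fun _ => leqnn _).
rewrite /spline_deriv mderiv_spline_piece //.
set j := block m x; set c := mderiv cube r f x.
have jm i : (j i < m i)%N by exact: block_lt.
have jx i : knot m j i false <= x 0 i <= knot m j i true by exact: block_knot.
have a01 k (b : bool) : 0 <= (knot m j k b : R) <= 1 by exact: knot_itv.
have dis k : k \in enum (~: M) -> k \notin enum M.
  by rewrite !mem_enum finset.in_setC.
(* Derivatives in the directions of [M] commute with interpolation in the others. *)
have [h1 e1] := partials_combs (fun i => spline_basis (m i) (j i)) dis a01 hf.
have := increments_bound (enum_uniq _) a01 (knot_side j) jx xc h1
  ucube_error_bound error_bound_nondecreasing (c := c).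
rewrite -/(interp m j) -/error_integral => H.
set D := foldr _ _ _ _ in H *.
(* The product of the [m i] cancels the product of the sides, so [c] can be taken under the common
   factor, where it becomes the value of the mixed increment for a constant derivative. *)
have -> : c - \prod_(i in M) (m i)%:R * D =
    - (\prod_(i in M) (m i)%:R * (D - c * \prod_(k <- enum M) side k)).
  by rewrite mulrBr mulrCA prod_side; ring.
rewrite normrN normrM (ger0_norm prod_m_ge0); apply: (ler_wpM2l prod_m_ge0).
apply: H => y yc _ yx; rewrite e1 // -/(interp m j).
apply: le_trans (interps_bound (enum_uniq _) jm jx _ yc _) _.
- by move=> z zc; exact: C_class_modulus_dist.
- by move=> k /dis; exact: yx.
- apply: (Omega_le Omega_MC (pnorm_ge0 _ _)).
  apply: le_pnorm => [|k]; first exact: p_itv.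
  rewrite !mxE mem_enum finset.in_setC negbK.
  by case: ifP => // _; rewrite normr_id.
Qed.

(** * The extremal function and the lower bound *)

Definition extremal_point : 'rV[R]_n := half_off (fun k => k \in M) 0.

Definition extremal_deriv z := Omega (pnorm p (z - extremal_point)).

(** This primitive vanishes on every face where a coordinate of [M] is 0, so its mixed increment
    over a block at the origin reduces to one corner value. *)
Definition extremal := pints (enum M) extremal_deriv.

Lemma ucube_extremal_deriv : ucube extremal_deriv.
Proof.
apply: ucube_Omega_pnorm => // x y k.
by rewrite !mxE opprB addrA subrK.
Qed.

Lemma extremal_point_cube : cube extremal_point.
Proof.
move=> k; rewrite !mxE; case: ifP => _; first by rewrite lexx ler01.
rewrite (ltW (half_gt0 k)) /= /half ler_pdivrMr ?mulr_gt0 // mul1r.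
by rewrite -natrM ler1n muln_gt0 /=.
Qed.

Lemma mderiv_extremal (t : {ffun 'I_n -> bool}) : (forall i, (t i <= r i)%N) ->
  has_mderiv cube t extremal /\ forall x, cube x ->
    mderiv cube t extremal x = pints (enum (M :\: supp t)) extremal_deriv x.
Proof.
move=> tr; apply: partials_pints; first exact: ucube_extremal_deriv.
apply: uniq_perm; rewrite ?cat_uniq ?enum_uniq //=.
  rewrite andbT; apply/hasPn => k; rewrite !mem_enum finset.in_setD.
  by case/andP.
move=> k; rewrite mem_cat !mem_enum finset.in_setD.
have [|//] := boolP (k \in supp t); rewrite !inE => tk.
by have := tr k; rewrite tk; case: (r k).
Qed.

Lemma mderiv_extremal_top x : cube x -> mderiv cube r extremal x = extremal_deriv x.
Proof.
move=> xc; have [_ ->] := mderiv_extremal (fun i => leqnn (r i)); last by [].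
by rewrite finset.setDv enum_set0.
Qed.

Lemma extremal_C_class_modulus : C_class_modulus r p Omega extremal.
Proof.
split.
  move=> t /mderiv_extremal[ht et]; split=> //.
  apply: ucube_continuous et; apply: ucube_pints; exact: ucube_extremal_deriv.
move=> gamma /andP[g0 _]; apply: ge_ereal_sup => _ [x [y [xc yc xy ->]]].
rewrite lee_fin !mderiv_extremal_top //.
apply: le_trans (Omega_pnorm_dist p_itv Omega_MC _ _) _.
by rewrite opprB addrA subrK; apply: (Omega_le Omega_MC (pnorm_ge0 _ _)).
Qed.

(** The scaled coordinate is 0 in [M] and 1/2 elsewhere; both truncate to 0. *)
Lemma block_extremal_point i : block m extremal_point i = 0%N.
Proof.
rewrite /block; have -> : Num.truncn ((m i)%:R * extremal_point 0 i) = 0%N.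
  apply/truncn0Pn; rewrite -ltNge !mxE; case: ifP => _.
    by rewrite mulr0 ltr01.
  have -> : (m i)%:R * half i = 2^-1 :> R by rewrite /half; field; rewrite gt_eqF.
  by rewrite invf_lt1 // ltr1n.
by rewrite min0n.
Qed.

(** The two interpolation weights add up to 1, so equal values at all the knots are reproduced. *)
Lemma interps_cst j t (F : 'rV[R]_n -> R) c y :
  (forall z, (forall k, k \notin t -> z 0 k = y 0 k) ->
     (forall k, k \in t -> exists b : bool, z 0 k = knot m j k b) -> F z = c) ->
  foldr (interp m j) F t y = c.
Proof.
elim: t y => [|i t IHt] y /= Fc; first by apply: Fc.
have H (b : bool) : foldr (interp m j) F t (set_coord y i (knot m j i b)) = c.
  apply: IHt => z zy zt; apply: Fc => k.
    rewrite inE negb_or => /andP[ki kt].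
    by rewrite zy // set_coord_neq.
  rewrite inE => kit; have [/zt //|kt] := boolP (k \in t).
  move: kit; rewrite (negbTE kt) orbF => /eqP ki; exists b.
  by rewrite zy // ki set_coord_eq.
by rewrite {1}/interp /comb !H /spline_basis; ring.
Qed.

(** Every term of the mixed increment that uses a lower end lies on a face where [F] vanishes; only
    the upper corner survives. *)
Lemma increments_vanishing (a : 'I_n -> bool -> R) t (F : 'rV[R]_n -> R) y :
  uniq t -> (forall k, a k false = 0) -> (forall k (b : bool), 0 <= a k b <= 1) ->
  (forall z, cube z -> (exists2 k, k \in t & z 0 k = 0) -> F z = 0) -> cube y ->
  foldr (increment a) F t y = F (set_coords t (fun k => a k true) y).
Proof.
move=> + a0 a01; elim: t F => [|i t IHt] F /=; first by rewrite set_coords_nil.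
move=> /andP[it ut] F0 yc.
rewrite {1}/increment foldr_combC // -/(increment a) IHt //; last first.
  move=> z zc [k kt zk].
  have ki : k != i by apply: contraNneq it => <-.
  rewrite -/(increment a i F) incrementE !F0 ?subrr //; try exact: set_coord_cube.
  - by exists k; rewrite ?inE ?kt ?orbT // set_coord_neq.
  - by exists k; rewrite ?inE ?kt ?orbT // set_coord_neq.
rewrite -/(increment a i F) incrementE -set_coords_cons [X in _ - X]F0 ?subr0 //.
  by apply: set_coord_cube => //; apply: set_coords_cube.
by exists i; rewrite ?mem_head // set_coord_eq.
Qed.

(** Outside [M] both knots are exactly half a step away from the extremal point, so all interpolated
    values coincide with the one given by [error_bound]; in [M] only the upper corner counts. *)
Lemma extremal_spline_deriv : spline_deriv m r extremal extremal_point =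
  \prod_(i in M) (m i)%:R * error_integral.
Proof.
rewrite /spline_deriv mderiv_spline_piece //; set j := block m extremal_point.
have j0 i : j i = 0%N by exact: block_extremal_point.
have a01 k (b : bool) : 0 <= (knot m j k b : R) <= 1 by rewrite knot_itv // j0.
have ud := ucube_extremal_deriv.
have MC k : (k \in enum (~: M)) = (k \notin enum M).
  by rewrite !mem_enum finset.in_setC.
have cz y z : cube y -> (forall k, k \notin enum (~: M) -> z 0 k = y 0 k) ->
    (forall k, k \in enum (~: M) -> exists b : bool, z 0 k = knot m j k b) -> cube z.
  by move=> yc zy zk k; have [/zk[b ->]|/zy ->] := boolP (k \in enum (~: M)).
congr (_ * _); rewrite increments_vanishing ?enum_uniq //; last 3 first.
- by move=> k; rewrite /knot j0 addn0 mul0r.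
- move=> y yc [k kM yk]; apply: interps_cst => z zy zk.
  apply: (pints_eq0 _ (enum_uniq _) ud (cz _ _ yc zy zk)).
  by exists k => //; rewrite zy // MC kM.
- exact: extremal_point_cube.
apply: interps_cst => z zy zk; rewrite /extremal /error_integral.
transitivity (pints (enum M) error_bound z).
  apply: eq_pints_on => y yz; rewrite /extremal_deriv /error_bound.
  apply: (congr1 Omega); apply: eq_pnorm => k; rewrite !mxE.
  case: ifP => kM; first by rewrite subr0.
  have kM' : k \notin enum M by rewrite mem_enum kM.
  have [|b yk] := zk k; first by rewrite MC.
  rewrite yz // yk // /knot j0 add0n (ger0_norm (ltW (half_gt0 k))) /half.
  have E : 1 / (m k)%:R - 1 / (2 * (m k)%:R) = 1 / (2 * (m k)%:R) :> R.
    by field; rewrite gt_eqF.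
  have h0 := ltW (half_gt0 k); rewrite /half in h0.
  case: b {yk} => /=; first by rewrite E ger0_norm.
  by rewrite mul0r sub0r normrN ger0_norm.
(* The integrated bound depends on the coordinates in [M] alone, and there [z] has the upper knot
   [1 / m k], the side of the box. *)
apply: (@eq_pints_coords _ _ (fun k => k \in M)).
- move=> y y' yy'; rewrite /error_bound; apply: (congr1 Omega); apply: eq_pnorm => k.
  by rewrite !mxE; case: ifP => // kM; rewrite yy'.
- by move=> k; rewrite mem_enum.
- move=> k kM; rewrite zy; last by rewrite MC mem_enum kM.
  by rewrite !mxE mem_enum kM /knot j0 add0n.
Qed.

Lemma EFin_error_integral :
  error_integral%:E = box_integral M side (fun gamma =>
    (Omega ((\sum_(i in M) gamma 0 i `^ p +
             \sum_(i in ~: M) 1 / (2 * (m i)%:R) `^ p) `^ p^-1))%R%:E).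
Proof.
apply: EFin_pints.
- exact: enum_uniq.
- exact: ucube_error_bound.
- by move=> k; rewrite mxE lexx ler01.
- by move=> k _; exact: side_itv.
move=> y yc; congr EFin; apply: (congr1 Omega); rewrite /pnorm; congr (_ `^ _).
rewrite (bigID (fun k => k \in M)) /=; congr (_ + _).
  apply: eq_bigr => k kM; rewrite mxE kM ger0_norm //.
  by case/andP: (yc k).
apply: eq_big => k; first by rewrite finset.in_setC.
move=> kM; rewrite mxE (negbTE kM) ger0_norm ?(ltW (half_gt0 k)) // /half.
have h : 0 < 2 * (m k)%:R :> R by rewrite mulr_gt0.
have hp := powR_gt0 p h.
(* The power stands outside the quotient on one side and only in the denominator on the other;
   multiplying by it reconciles the two. *)
apply: (mulIf (lt0r_neq0 hp)).
rewrite -powRM ?(ltW h) ?divr_ge0 ?ler01 ?(ltW h) //.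
by rewrite !divfK ?(lt0r_neq0 h) ?(lt0r_neq0 hp) // powR1.
Qed.

Lemma worst_error_eq :
  worst_error m r (C_class_modulus r p Omega) =
  (\prod_(i in M) (m i)%:R * error_integral)%:E.
Proof.
apply/eqP; rewrite eq_le; apply/andP; split.
  apply: ge_ereal_sup => _ [f fC <-]; apply: ge_ereal_sup => _ [x xc <-].
  by rewrite lee_fin; exact: error_le.
apply: (@le_trans _ _ (ereal_sup [set `|mderiv cube r extremal x -
    spline_deriv m r extremal x|%:E | x in cube])); last first.
  by apply: ereal_sup_ubound; exists extremal => //; exact: extremal_C_class_modulus.
apply: ereal_sup_ubound; exists extremal_point; first exact: extremal_point_cube.
rewrite mderiv_extremal_top; last exact: extremal_point_cube.
(* The derivative of the extremal function vanishes at this point, so the error there is the spline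
   derivative alone. *)
have -> : extremal_deriv extremal_point = 0.
  rewrite /extremal_deriv subrr; have := @pnorm_le_cst R n p p_itv 0 0 (lexx _).
  rewrite mulr0 => H.
  have -> : pnorm p (0 : 'rV[R]_n) = 0.
    apply/eqP; rewrite eq_le pnorm_ge0 andbT; apply: H => k.
    by rewrite mxE normr0.
  exact: MC_0 Omega_MC.
rewrite extremal_spline_deriv sub0r normrN ger0_norm //.
(* The claimed value is nonnegative because, by the upper bound, it dominates an absolute value. *)
exact: le_trans (normr_ge0 _) (error_le extremal_C_class_modulus extremal_point_cube).
Qed.

End extremal.

Theorem theorem4 (R : realType) (n : nat) (n_ge1 : (1 <= n)%N)
    (p : R) (p_itv : 1 <= p <= 3) (r : {ffun 'I_n -> bool})
    (Omega : R -> R) (Omega_MC : MC_type Omega)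
    (Omega_concave : concave_function `[0, +oo[ Omega)
    (m : 'I_n -> nat) (m_ge2 : forall i, (2 <= m i)%N) :
  let M := supp r in
  worst_error m r (C_class_modulus r p Omega) =
  ((\prod_(i in M) (m i)%:R)%R%:E *
   box_integral M (fun i => 1 / (m i)%:R)%R
     (fun gamma =>
        (Omega ((\sum_(i in M) gamma 0 i `^ p +
                 \sum_(i in ~: M) 1 / (2 * (m i)%:R) `^ p) `^ p^-1))%R%:E))%E.
Proof.
have m_gt0 i : (0 < m i)%N by rewrite (leq_trans _ (m_ge2 i)).
move=> M; rewrite (worst_error_eq p_itv Omega_MC Omega_concave r m_gt0).
by rewrite EFinM (EFin_error_integral p_itv Omega_MC r m_gt0).
Qed.
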